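(* Let $H$ and $K$ be complex infinite-dimensional separable Hilbert spaces, and let $A\in B(H)$, $B\in B(K)$. Then $$\bigcap_{C\in \Phi(K,H)}\sigma_{e}(M_{C})=\bigcap_{C\in G(K,H)}\sigma_{e}(M_{C})=\bigcap_{C\in B(K,H)}\sigma_{e}(M_{C})$$ $$=\sigma_{SF+}(A)\cup \sigma_{SF-}(B)\cup\{\lambda\in \mathbb{C}: \min(\beta(A-\lambda),\alpha(B-\lambda))<\max(\beta(A-\lambda),\alpha(B-\lambda))=\infty\}.$$
   Context: $B(H,K)$ is the set of bounded linear operators from $H$ to $K$, and $B(H)=B(H,H)$. For $T\in B(H,K)$, $N(T)$ and $R(T)$ are its kernel and range, $\alpha(T)=\dim N(T)$ and $\beta(T)=\dim (K/R(T))$; any infinite dimension is written $\infty$, i.e. $\alpha(T),\beta(T)\in\{0,1,2,\dots\}\cup\{\infty\}$. $T$ is upper semi-Fredholm if $R(T)$ is closed and $\alpha(T)<\infty$; lower semi-Fredholm if $\beta(T)<\infty$; Fredholm if it is upper or lower semi-Fredholm and $\alpha(T)<\infty$, $\beta(T)<\infty$. $G(K,H)$ and $\Phi(K,H)$ denote the sets of invertible operators and of Fredholm operators from $K$ to $H$. For an operator $T$ on a Hilbert space: $\sigma_{SF+}(T)$ is the set of $\lambda\in\mathbb{C}$ such that $T-\lambda I$ is not upper semi-Fredholm; $\sigma_{SF-}(T)$ is the set of $\lambda\in\mathbb{C}$ such that $T-\lambda I$ is not lower semi-Fredholm; the essential spectrum $\sigma_e(T)$ is the set of $\lambda\in\mathbb{C}$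 such that $T-\lambda I$ is not Fredholm. $T-\lambda$ means $T-\lambda I$. For $C\in B(K,H)$, $M_C=\begin{pmatrix}A&C\\0&B\end{pmatrix}\in B(H\oplus K)$, i.e. $M_C(x,y)=(Ax+Cy,By)$. *)

(* Defs.v *)
From HB Require Import structures.
From mathcomp Require Import all_boot all_order all_algebra.
From mathcomp Require Import complex ring.
From mathcomp Require Import all_classical all_reals all_analysis.

Set Implicit Arguments.
Unset Strict Implicit.
Unset Printing Implicit Defensive.

Import Order.TTheory GRing.Theory Num.Theory Num.Def.
Import numFieldNormedType.Exports.

Local Open Scope classical_set_scope.
Local Open Scope ring_scope.

HB.mixin Record isHilbert (R : realType) H & CompleteNormedModule R[i] H := {
  hdot : {dot H for (@conjC R[i])} ;
  hdotE : forall x : H, `|x| ^+ 2 = hdot x x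
}.

#[short(type="hilbertType")]
HB.structure Definition Hilbert (R : realType) :=
  {H of CompleteNormedModule R[i] H & isHilbert R H}.

(* The type is H * K, but not its library instances: the norm of H * K is the
   maximum of the norms of the components, which is not a Hilbert norm. *)
Definition hsum (R : realType) (H K : hilbertType R) : Type := (H * K)%type.

Section HilbertSum.
Variables (R : realType) (H K : hilbertType R).
Local Notation C := R[i].
Implicit Types u v : hsum H K.

HB.instance Definition _ := GRing.Lmodule.copy (hsum H K) (H * K)%type.

Definition hsum_dot u v : C := hdot u.1 v.1 + hdot u.2 v.2.

Definition hsum_norm u : C := sqrtC (`|u.1| ^+ 2 + `|u.2| ^+ 2).

Lemma sqrnD_ge0 (a b : C) : 0 <= a -> 0 <= b -> 0 <= a ^+ 2 + b ^+ 2.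
Proof. by move=> a0 b0; rewrite addr_ge0 ?exprn_ge0. Qed.

Lemma hsum_normD u v : hsum_norm (u + v) <= hsum_norm u + hsum_norm v.
Proof.
rewrite /hsum_norm /=.
have := ler_normD u.1 v.1; have := ler_normD u.2 v.2.
move: (normr_ge0 u.1) (normr_ge0 v.1) (normr_ge0 u.2) (normr_ge0 v.2).
move: (normr_ge0 (u.1 + v.1)) (normr_ge0 (u.2 + v.2)).
move: `|u.1| `|v.1| `|u.2| `|v.2| `|u.1 + v.1| `|u.2 + v.2|.
move=> a c b d e f e0 f0 a0 c0 b0 d0 fbd eac.
have h0 : 0 <= sqrtC (a ^+ 2 + b ^+ 2) + sqrtC (c ^+ 2 + d ^+ 2).
  by rewrite addr_ge0 // sqrtC_ge0 sqrnD_ge0.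
rewrite -(@ler_sqr C) ?nnegrE ?sqrtC_ge0 ?sqrnD_ge0 // sqrtCK sqrrD !sqrtCK.
apply: (@le_trans _ _ ((a + c) ^+ 2 + (b + d) ^+ 2)).
  by apply: lerD; rewrite ler_sqr ?nnegrE // addr_ge0.
have -> : (a + c) ^+ 2 + (b + d) ^+ 2 =
    a ^+ 2 + b ^+ 2 + (a * c + b * d) *+ 2 + (c ^+ 2 + d ^+ 2) by ring.
rewrite lerD2r lerD2l lerMn2r /= -sqrtCM ?nnegrE ?sqrnD_ge0 //.
rewrite -(@ler_sqr C) ?nnegrE ?sqrtC_ge0 ?mulr_ge0 ?sqrnD_ge0 ?addr_ge0 ?mulr_ge0 //.
rewrite sqrtCK -subr_ge0.
have -> : (a ^+ 2 + b ^+ 2) * (c ^+ 2 + d ^+ 2) - (a * c + b * d) ^+ 2 =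
    (a * d - b * c) ^+ 2 by ring.
by rewrite real_exprn_even_ge0 // rpredB // ger0_real // mulr_ge0.
Qed.

Lemma hsum_normZ (l : C) u : hsum_norm (l *: u) = `|l| * hsum_norm u.
Proof.
rewrite /hsum_norm /= !normrZ !exprMn -mulrDr sqrtCM ?nnegrE ?exprn_ge0 //.
  by rewrite sqrCK.
Qed.

Lemma hsum_norm_eq0 u : hsum_norm u = 0 -> u = 0.
Proof.
move/eqP; rewrite sqrtC_eq0 paddr_eq0 ?exprn_ge0 // !sqrf_eq0 !normr_eq0.
by case: u => x y /= /andP[/eqP-> /eqP->].
Qed.

HB.instance Definition _ := @Lmodule_isNormed.Build C (hsum H K) hsum_norm
  hsum_normD hsum_normZ hsum_norm_eq0.

Lemma hsum_normE u : `|u| = sqrtC (`|u.1| ^+ 2 + `|u.2| ^+ 2).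
Proof. by []. Qed.

Lemma hsum_norm1 u : `|u.1| <= `|u|.
Proof.
rewrite hsum_normE -(@ler_sqr C) ?nnegrE ?sqrtC_ge0 ?sqrnD_ge0 //.
by rewrite sqrtCK lerDl exprn_ge0.
Qed.

Lemma hsum_norm2 u : `|u.2| <= `|u|.
Proof.
rewrite hsum_normE -(@ler_sqr C) ?nnegrE ?sqrtC_ge0 ?sqrnD_ge0 //.
by rewrite sqrtCK lerDr exprn_ge0.
Qed.

Lemma hsum_norm_le u : `|u| <= `|u.1| + `|u.2|.
Proof.
rewrite hsum_normE -(@ler_sqr C) ?nnegrE ?sqrtC_ge0 ?sqrnD_ge0 ?addr_ge0 //.
by rewrite sqrtCK sqrrD lerD2r lerDl mulrn_wge0 // mulr_ge0.
Qed.

Lemma hsum1_continuous : continuous (fun u : hsum H K => u.1).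
Proof.
move=> u; apply/(@cvgrPdist_lt _ _ _ (nbhs u)) => e e0; near=> v.
apply: le_lt_trans (hsum_norm1 (u - v)) _.
by near: v; apply: cvgr_dist_lt.
Unshelve. all: by end_near. Qed.

Lemma hsum2_continuous : continuous (fun u : hsum H K => u.2).
Proof.
move=> u; apply/(@cvgrPdist_lt _ _ _ (nbhs u)) => e e0; near=> v.
apply: le_lt_trans (hsum_norm2 (u - v)) _.
by near: v; apply: cvgr_dist_lt.
Unshelve. all: by end_near. Qed.

Lemma cvg_hsum (F : set_system (hsum H K)) (FF : Filter F) (x : H) (y : K) :
  (fun u : hsum H K => u.1) @ F --> x -> (fun u : hsum H K => u.2) @ F --> y ->
  F --> ((x, y) : hsum H K).
Proof.
move=> /cvgrPdist_lt cx /cvgrPdist_lt cy; apply/cvgrPdist_lt => e e0.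
have e20 : 0 < e / 2 by rewrite divr_gt0.
near=> u.
apply: le_lt_trans (hsum_norm_le _) _; rewrite [e]splitr ltrD //=.
  by near: u; exact: cx.
by near: u; exact: cy.
Unshelve. all: by end_near. Qed.

Lemma hsum_complete (F : set_system (hsum H K)) :
  ProperFilter F -> cauchy F -> cvg F.
Proof.
move=> FF /cauchy_ballP Fc.
have c1 : cauchy ((fun u : hsum H K => u.1) @ F).
  apply/cauchy_ballP => e e0; rewrite near_map2.
  apply: filterS (Fc e e0) => -[u v].
  rewrite -!ball_normE /= /ball_ /=; apply: le_lt_trans.
  exact: (hsum_norm1 (u - v)).
have c2 : cauchy ((fun u : hsum H K => u.2) @ F).
  apply/cauchy_ballP => e e0; rewrite near_map2.
  apply: filterS (Fc e e0) => -[u v].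
  rewrite -!ball_normE /= /ball_ /=; apply: le_lt_trans.
  exact: (hsum_norm2 (u - v)).
have /cvg_ex[x cx] : cvg ((fun u : hsum H K => u.1) @ F) by exact: cauchy_cvg.
have /cvg_ex[y cy] : cvg ((fun u : hsum H K => u.2) @ F) by exact: cauchy_cvg.
by apply/cvg_ex; exists ((x, y) : hsum H K); exact: cvg_hsum.
Qed.

HB.instance Definition _ := Uniform_isComplete.Build (hsum H K) hsum_complete.

Let hsum_dot_zmodl v : zmod_morphism (hsum_dot^~ v).
Proof. by move=> u w; rewrite /hsum_dot /= !linearBl opprD addrACA. Qed.

Let hsum_dot_zmodr u : zmod_morphism (hsum_dot u).
Proof. by move=> v w; rewrite /hsum_dot /= !linearBr opprD addrACA. Qed.

Let hsum_dot_scalel v : scalable_for *%R (hsum_dot^~ v).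
Proof. by move=> a u; rewrite /hsum_dot /= !linearZl_LR mulrDr. Qed.

Let hsum_dot_scaler u : scalable_for (@conjC C \; *%R) (hsum_dot u).
Proof. by move=> a v; rewrite /hsum_dot /= !linearZr_LR /= mulrDr. Qed.

HB.instance Definition _ := isBilinear.Build C (hsum H K) (hsum H K) C
  *%R (@conjC C \; *%R) hsum_dot
  hsum_dot_zmodl hsum_dot_zmodr hsum_dot_scalel hsum_dot_scaler.

Let hsum_dot_herm u v : hsum_dot u v = (-1) ^+ false * conjC (hsum_dot v u).
Proof.
rewrite /hsum_dot expr0 mul1r rmorphD /=.
by rewrite (hermC hdot u.1) (hermC hdot u.2) !expr0 !mul1r.
Qed.

HB.instance Definition _ := isHermitianSesquilinear.Build C (hsum H K) false
  (@conjC C) hsum_dot hsum_dot_herm.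

Let hsum_normP u : `|u| ^+ 2 = hsum_dot u u.
Proof. by rewrite hsum_normE sqrtCK /hsum_dot !hdotE. Qed.

Let hsum_dot_gt0 u : u != 0 -> 0 < hsum_dot u u.
Proof. by move=> u0; rewrite -hsum_normP exprn_gt0 // normr_gt0. Qed.

HB.instance Definition _ := isDotProduct.Build C (hsum H K) hsum_dot
  hsum_dot_gt0.

HB.instance Definition _ := isHilbert.Build R (hsum H K) hsum_normP.

End HilbertSum.

HB.mixin Record isBounded (R : realType) (H K : hilbertType R) (T : H -> K) := {
  bounded_subproof : bounded_near T (nbhs (0 : H))
}.

HB.structure Definition BoundedLinear (R : realType) (H K : hilbertType R) :=
  {T of isBounded R H K T & @GRing.Linear R[i] H K *:%R T}.

Notation "'B( H , K )" := (BoundedLinear.type H K)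
  (at level 0, format "''B(' H ,  K )") : type_scope.
Notation "'B( H )" := 'B(H, H)
  (at level 0, format "''B(' H )") : type_scope.

Lemma bounded_continuous (R : realType) (H K : hilbertType R) (T : 'B(H, K)) :
  continuous T.
Proof. exact/linear_bounded_continuous/bounded_subproof. Qed.

Section Operators.
Variables (R : realType) (H K : hilbertType R).
Local Notation C := R[i].

Definition minus_scalar (T : 'B(H)) (l : C) : H -> H := fun x => T x - l *: x.

Let minus_scalar_linear T l : linear (minus_scalar T l).
Proof.
move=> a x y.
by rewrite /minus_scalar linearP scalerDr scalerBr !scalerA opprD addrACA (mulrC l).
Qed.

HB.instance Definition _ T l := GRing.isLinear.Build C H H *:%R (minus_scalar T l)
  (@minus_scalar_linear T l).

Let minus_scalar_bounded T l : bounded_near (minus_scalar T l) (nbhs (0 : H)).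
Proof.
apply/(linear_bounded_continuous (minus_scalar T l)) => x.
by apply: cvgB; [exact: bounded_continuous | exact: cvgZr].
Qed.

HB.instance Definition _ T l := isBounded.Build R H H (minus_scalar T l)
  (@minus_scalar_bounded T l).

(* The operator matrix with rows (A, T) and (0, B). *)
Definition upper_triangular (A : 'B(H)) (B : 'B(K)) (T : 'B(K, H)) :
    hsum H K -> hsum H K :=
  fun u => (A u.1 + T u.2, B u.2).

Let upper_triangular_linear A B T : linear (upper_triangular A B T).
Proof.
move=> a u v; rewrite /upper_triangular /= !linearP; congr (_, _).
by rewrite /= scalerDr addrACA.
Qed.

HB.instance Definition _ A B T := GRing.isLinear.Build C (hsum H K) (hsum H K)
  *:%R (upper_triangular A B T) (@upper_triangular_linear A B T).

Let upper_triangular_bounded A B T :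
  bounded_near (upper_triangular A B T) (nbhs (0 : hsum H K)).
Proof.
apply/(linear_bounded_continuous (upper_triangular A B T)) => u.
have cA : (fun v : hsum H K => A v.1) @ nbhs u --> A u.1.
  exact: (continuous_comp (@hsum1_continuous _ H K u)
           (@bounded_continuous _ _ _ A _)).
have cT : (fun v : hsum H K => T v.2) @ nbhs u --> T u.2.
  exact: (continuous_comp (@hsum2_continuous _ H K u)
           (@bounded_continuous _ _ _ T _)).
have cB : (fun v : hsum H K => B v.2) @ nbhs u --> B u.2.
  exact: (continuous_comp (@hsum2_continuous _ H K u)
           (@bounded_continuous _ _ _ B _)).
apply: (@cvg_hsum _ _ _ (upper_triangular A B T @ nbhs u)) => //.
exact: (cvgD cA cT).
Qed.

HB.instance Definition _ A B T := isBounded.Build R (hsum H K) (hsum H K)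
  (upper_triangular A B T) (@upper_triangular_bounded A B T).

End Operators.

Section Dimension.
Variables (R : realType) (V : lmodType R[i]).

(* For subspaces W `<=` U, the classes of the v i form a basis of U / W. *)
Definition is_quotient_basis (U W : set V) (n : nat) (v : 'I_n -> V) : Prop :=
  (forall i, U (v i)) /\
  (forall x, U x ->
     exists! c : 'I_n -> R[i], W (x - \sum_(i < n) c i *: v i)).

(* All finite bases have the same cardinality, so the infimum is over at most
   one value; it is +oo when there is no finite basis. *)
Definition quotient_dim (U W : set V) : \bar R :=
  ereal_inf [set (n%:R)%:E | n in
    [set n : nat | exists v : 'I_n -> V, is_quotient_basis U W v]].

Definition subspace_dim (U : set V) : \bar R := quotient_dim U [set 0].

End Dimension.

Section Fredholm.
Variable R : realType.
Implicit Types H K : hilbertType R.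

Definition nullity H K (T : 'B(H, K)) : \bar R := subspace_dim [set x | T x = 0].

Definition defect H K (T : 'B(H, K)) : \bar R :=
  quotient_dim [set: K] (range T).

Definition upper_semi_Fredholm H K (T : 'B(H, K)) : Prop :=
  closed (range T) /\ (nullity T < +oo)%E.

Definition lower_semi_Fredholm H K (T : 'B(H, K)) : Prop :=
  (defect T < +oo)%E.

Definition Fredholm H K (T : 'B(H, K)) : Prop :=
  (upper_semi_Fredholm T \/ lower_semi_Fredholm T) /\
  (nullity T < +oo)%E /\ (defect T < +oo)%E.

Definition invertible_op H K (T : 'B(H, K)) : Prop :=
  exists S : 'B(K, H), cancel T S /\ cancel S T.

Definition sigma_SFp H (T : 'B(H)) : set R[i] :=
  [set l | ~ upper_semi_Fredholm (minus_scalar T l)].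

Definition sigma_SFm H (T : 'B(H)) : set R[i] :=
  [set l | ~ lower_semi_Fredholm (minus_scalar T l)].

Definition sigma_e H (T : 'B(H)) : set R[i] :=
  [set l | ~ Fredholm (minus_scalar T l)].

End Fredholm.

Definition separable_space (T : topologicalType) : Prop :=
  exists2 D : set T, countable D & dense D.

(* Main.v *)
Require Import Defs.
From HB Require Import structures.
From mathcomp Require Import all_boot all_order all_algebra.
From mathcomp Require Import complex.
From mathcomp Require Import all_classical all_reals all_analysis.
From mathcomp Require Import ring.

Set Implicit Arguments.
Unset Strict Implicit.
Unset Printing Implicit Defensive.

Import Order.TTheory GRing.Theory Num.Theory.
Import numFieldNormedType.Exports.

Local Open Scope classical_set_scope.
Local Open Scope ring_scope.

(** Fix a scalar l and write A, B for A - l, B - l, and M for the operator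
    matrix with rows (A, C) and (0, B).

    The heart of the matter is the exact sequence
      0 -> N(A) -> N(M) -> N(B) -> H / R(A) -> (H + K) / R(M) -> K / R(B) -> 0
    whose middle arrow is induced by C. By exactness, M has finite nullity and
    defect if and only if N(A) and K / R(B) are finite-dimensional and the map
    N(B) -> H / R(A) induced by C has finite-dimensional kernel and cokernel
    ([triangular_finiteP]). In particular N(B) and H / R(A) are then both
    finite-dimensional or both infinite-dimensional, so no C works for the l
    in the third set on the right-hand side.

    If M is Fredholm, R(A) is also closed ([closed_range_of_Fredholm]): an
    operator T whose range has finite codimension maps closed subspaces that
    contain N(T) to closed subspaces ([closed_image]), and R(A) + 0 is the image
    under M of H + N', where N', the projection of N(M) to K, has finite
    dimension. The closed-image property is a form of the open mapping theorem
    ([open_mapping]): if T X + S = Y for a closed subspace S, then T solves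
    T x = y modulo S with a norm bound. Using a finite-dimensional complement S
    of the range avoids quotient spaces.

    Conversely, let A be upper and B lower semi-Fredholm. When H / R(A) and N(B)
    are finite-dimensional, every C makes M Fredholm, so any unitary C does; one
    exists because an infinite-dimensional separable Hilbert space has an
    orthonormal basis indexed by the natural numbers. When both are
    infinite-dimensional, so are the orthogonal complements: N(B)^perp because
    B restricted to it has range R(B), which has finite codimension in K, and
    R(A) because N(A) is finite-dimensional. All four spaces then have
    countable orthonormal bases, and a unitary C taking N(B) onto R(A)^perp and
    N(B)^perp onto R(A) induces a bijection N(B) -> H / R(A)
    ([exists_matching_unitary]). Thus a C that works at all can be replaced by
    an invertible one, which is why the three intersections agree. *)

(** * Subspaces of finite relative dimension *)

Section Subspaces.
Variable F : fieldType.
Implicit Types V X : lmodType F.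

Definition subspace V (U : set V) : Prop :=
  U 0 /\ forall a x y, U x -> U y -> U (a *: x + y).

Lemma subspace0 V (U : set V) : subspace U -> U 0.
Proof. by case. Qed.

Lemma subspaceD V (U : set V) x y : subspace U -> U x -> U y -> U (x + y).
Proof. by case=> _ sU Ux Uy; rewrite -[x]scale1r; exact: sU. Qed.

Lemma subspaceZ V (U : set V) a x : subspace U -> U x -> U (a *: x).
Proof. by case=> U0 sU Ux; rewrite -[_ *: _]addr0; exact: sU. Qed.

Lemma subspaceB V (U : set V) x y : subspace U -> U x -> U y -> U (x - y).
Proof. by case=> _ sU Ux Uy; rewrite addrC -scaleN1r; exact: sU. Qed.

Lemma subspaceT V : subspace [set: V].
Proof. by []. Qed.

Lemma subspace1 V : subspace [set 0 : V].
Proof. by split=> // a x y -> ->; rewrite /= scaler0 addr0. Qed.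

Lemma subspaceI V (U W : set V) : subspace U -> subspace W -> subspace (U `&` W).
Proof.
move=> [U0 sU] [W0 sW]; split=> // a x y [Ux Wx] [Uy Wy].
by split; [exact: sU | exact: sW].
Qed.

Lemma linear_map0 V X (T : X -> V) : linear T -> T 0 = 0.
Proof. by move=> linT; have := linT (-1) 0 0; rewrite scaler0 addr0 scaleN1r addNr. Qed.

Lemma linear_mapZ V X (T : X -> V) a : linear T -> {morph T : x / a *: x}.
Proof. by move=> linT x; rewrite -[a *: x]addr0 linT linear_map0 ?addr0. Qed.

Lemma linear_mapD V X (T : X -> V) : linear T -> {morph T : x y / x + y}.
Proof. by move=> linT x y; rewrite -[x in LHS]scale1r linT scale1r. Qed.

Lemma linear_mapB V X (T : X -> V) : linear T -> {morph T : x y / x - y}.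
Proof. by move=> linT x y; rewrite addrC -scaleN1r linT scaleN1r addrC. Qed.

Lemma subspace_preimage V X (T : X -> V) (U : set V) :
  linear T -> subspace U -> subspace (T @^-1` U).
Proof.
move=> linT [U0 sU]; split=> [|a x y]; rewrite /preimage /= ?linear_map0 // linT.
exact: sU.
Qed.

Lemma subspace_image V X (T : X -> V) (U : set X) :
  linear T -> subspace U -> subspace (T @` U).
Proof.
move=> linT [U0 sU]; split=> [|a _ _ [x Ux <-] [y Uy <-]].
  by exists 0; rewrite ?linear_map0.
by exists (a *: x + y); [exact: sU | exact: linT].
Qed.

Lemma subspace_ker V X (T : X -> V) : linear T -> subspace [set x | T x = 0].
Proof. by move=> linT; exact: (subspace_preimage linT (@subspace1 V)). Qed.

Lemma subspace_range V X (T : X -> V) : linear T -> subspace (range T).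
Proof. by move=> linT; exact: (subspace_image linT (@subspaceT X)). Qed.

(** The sum of W and the span of s. The recursion on s lets the dimension
    arguments below proceed one vector at a time. *)
Fixpoint adjoin V (W : set V) (s : seq V) : set V :=
  if s is v :: s' then [set x | exists c, adjoin W s' (x - c *: v)] else W.

Lemma subspace_adjoin V (W : set V) s : subspace W -> subspace (adjoin W s).
Proof.
move=> sW; elim: s => //= v s [IH0 IH]; split=> [|a x y [c cx] [d dy]].
  by exists 0; rewrite scale0r subr0.
exists (a * c + d); have := IH a _ _ cx dy; congr (adjoin W s _).
by rewrite scalerBr scalerA scalerDl opprD addrACA.
Qed.

Lemma adjoin_sub V (W W' : set V) s : W `<=` W' -> adjoin W s `<=` adjoin W' s.
Proof. by move=> sW; elim: s => //= v s IH x [c /IH]; exists c. Qed.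

Lemma sub_adjoin V (W : set V) s : W `<=` adjoin W s.
Proof. by elim: s => //= v s IH x /IH Wx; exists 0; rewrite scale0r subr0. Qed.

Lemma adjoin_cat V (W : set V) s t : adjoin W (s ++ t) = adjoin (adjoin W t) s.
Proof. by elim: s => //= v s ->. Qed.

Lemma adjoin_le V (U W : set V) s : subspace U -> W `<=` U ->
  (forall v, v \in s -> U v) -> adjoin W s `<=` U.
Proof.
move=> sU WU; elim: s => //= v s IH sv x [c] /IH Uxc.
rewrite -[x](subrK (c *: v)); apply: subspaceD => //.
  by apply: Uxc => w ws; apply: sv; rewrite inE ws orbT.
by apply: subspaceZ => //; apply: sv; rewrite inE eqxx.
Qed.

Lemma mem_adjoin V (W : set V) s v : subspace W -> v \in s -> adjoin W s v.
Proof.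
move=> sW; elim: s => //= w s IH; rewrite inE => /orP[/eqP ->|/IH vs].
  by exists 1; rewrite scale1r subrr; exact: subspace0 (subspace_adjoin _ sW).
by exists 0; rewrite scale0r subr0.
Qed.

(** Finite dimension of (U + W) / W. As a mere inclusion it is stable under
    enlarging W and shrinking U; [adjoin_restrict] finds the spanning vectors
    inside U. *)
Definition finite_over V (U W : set V) : Prop := exists s, U `<=` adjoin W s.

Lemma finite_over_trans V (U W Z : set V) :
  finite_over U W -> finite_over W Z -> finite_over U Z.
Proof.
move=> [s sU] [t sW]; exists (s ++ t); rewrite adjoin_cat.
by apply: (subset_trans sU); exact: adjoin_sub.
Qed.

(** U / W maps onto (U + Z) / Z. *)
Lemma finite_over_add V (U W P Z : set V) : subspace Z -> finite_over U W ->
  W `<=` Z -> (forall x, P x -> exists2 u, U u & Z (x - u)) -> finite_over P Z.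
Proof.
move=> sZ [s sU] WZ sP; exists s => x /sP[u Uu Zxu].
rewrite -(subrK u x); apply: subspaceD; first exact: subspace_adjoin.
  exact: sub_adjoin.
exact/(adjoin_sub WZ)/sU.
Qed.

Lemma finite_over_sub V (U W P Z : set V) :
  finite_over U W -> P `<=` U -> W `<=` Z -> finite_over P Z.
Proof.
by move=> [s sU] PU WZ; exists s => x /PU /sU; exact: adjoin_sub.
Qed.

Lemma finite_over_image V X (T : X -> V) (U W : set X) : linear T ->
  finite_over U W -> finite_over (T @` U) (T @` W).
Proof.
move=> linT [s sU]; exists (map T s) => _ [x /sU xs <-].
elim: s x xs {sU} => [|v s IH] x /= => [Wx|[c /IH]]; first by exists x.
by exists c; rewrite -(linear_mapZ _ linT) -(linear_mapB linT).
Qed.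

(** A subspace of a finite-dimensional quotient is finite-dimensional, in a form
    that covers preimages. For the last vector w either all of T P avoids it,
    or some u in P has a nonzero w-component; subtracting multiples of u then
    kills the w-component on all of P. *)
Lemma adjoin_restrict V X (T : X -> V) (P : set X) (W : set V) s :
  linear T -> subspace P -> subspace W -> P `<=` T @^-1` adjoin W s ->
  exists2 t, (forall v, v \in t -> P v) & P `<=` adjoin (P `&` T @^-1` W) t.
Proof.
move=> linT sP sW; elim: s P sP => /= [|w s IH] P sP PW.
  by exists [::] => // x Px; split=> //; exact: PW.
pose Q := P `&` T @^-1` adjoin W s.
have sA : subspace (adjoin W s) by exact: subspace_adjoin.
have sQ : subspace Q by apply: subspaceI => //; exact: subspace_preimage.
have [t tQ Qt] := IH Q sQ (@subIsetr _ _ _).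
have QP : Q `&` T @^-1` W `<=` P `&` T @^-1` W by move=> x [[]].
have [PQ|/existsNP[u /not_implyP[Pu nu]]] := pselect (P `<=` Q).
  exists t => [v /tQ[]//|x /PQ /Qt]; exact: adjoin_sub.
have [c cu] := PW _ Pu; have c0 : c != 0.
  apply/eqP => c0; apply: nu; split=> //.
  by move: cu; rewrite c0 scale0r subr0.
exists (u :: t) => [v|x Px].
  by rewrite inE => /orP[/eqP->//|/tQ[]].
have [d dx] := PW _ Px; exists (d / c).
apply: (adjoin_sub QP); apply: Qt; split.
  by apply: subspaceB => //; exact: subspaceZ.
have := sA.2 (- (d / c)) _ _ cu dx; rewrite /preimage /=; congr (adjoin W s _).
rewrite (linear_mapB linT) (linear_mapZ _ linT) scalerBr scalerA mulNr divfK //.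
by rewrite !scaleNr opprK addrACA subrr addr0 addrC.
Qed.

Lemma finite_over_preimage V X (T : X -> V) (P : set X) (U W : set V) :
  linear T -> subspace P -> subspace W -> finite_over U W -> P `<=` T @^-1` U ->
  finite_over P (P `&` T @^-1` W).
Proof.
move=> linT sP sW [s sU] PU.
have [|t _ Pt] := adjoin_restrict (s := s) linT sP sW.
  by move=> x /PU /sU.
by exists t.
Qed.

Lemma finite_over_spanE V (U W : set V) : subspace U -> subspace W -> W `<=` U ->
  finite_over U W -> exists s, U = adjoin W s.
Proof.
move=> sU sW WU [s Us].
have linI : linear (idfun : V -> V) by [].
have [t tU Ut] := adjoin_restrict linI sU sW Us.
exists t; apply/seteqP; split; last exact: adjoin_le.
by move=> x /Ut; apply: adjoin_sub => y [].
Qed.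

(** A finite-dimensional algebraic complement of W in W + span s: the vectors of
    s that already lie in W plus the span of their successors are dropped. *)
Lemma finite_complement V (W : set V) s : subspace W -> exists t,
  [/\ adjoin [set 0] t `<=` adjoin W s,
    (forall x, adjoin W s x -> exists2 w, W w & adjoin [set 0] t (x - w)) &
    W `&` adjoin [set 0] t `<=` [set 0]].
Proof.
move=> sW; have s0 := @subspace1 V; elim: s => [|v s [t [tW Wt Wt0]]].
  exists [::]; split=> [_ ->|x Wx|x []//]; first exact: subspace0.
  by exists x; rewrite ?subrr.
have sA : subspace (adjoin W s) by exact: subspace_adjoin.
have [vs|vs] := pselect (adjoin W s v).
  exists t; split=> // [x /tW|x [c xc]]; first exact: (@sub_adjoin _ _ [:: v]).
  by apply: Wt; rewrite -(subrK (c *: v) x); apply: subspaceD => //; exact: subspaceZ.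
exists (v :: t); split=> [x [c /tW]|x [c /Wt[w Ww xw]]|x [Wx [c xc]]].
- by exists c.
- by exists w => //; exists c; rewrite addrAC.
have [c0|c0] := eqVneq c 0.
  by apply: Wt0; split=> //; move: xc; rewrite c0 scale0r subr0.
case: vs; rewrite -[v]scale1r -(mulVf c0) -scalerA; apply: subspaceZ => //.
rewrite -[c *: v](subKr x); apply: subspaceB => //; last exact: tW.
exact: sub_adjoin.
Qed.

End Subspaces.

Section QuotientDim.
Variables (R : realType) (V : lmodType R[i]).
Implicit Types U W : set V.

(** Dropping every redundant vector from s leaves a basis of the quotient; a
    vector outside the span of its successors has a uniquely determined
    coefficient. *)
Lemma adjoin_basis W s : subspace W ->
  exists n (v : 'I_n -> V), is_quotient_basis (adjoin W s) W v.
Proof.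
move=> sW; elim: s => [|w s [n [v [Uv bv]]]].
  exists 0, (fun=> 0); split=> [[]//|x Wx]; exists (fun=> 0).
  split=> [|c _]; first by rewrite big_ord0 subr0.
  by apply/funext => -[].
have sA : subspace (adjoin W s) by exact: subspace_adjoin.
have [ws|ws] := pselect (adjoin W s w).
  suff -> : adjoin W (w :: s) = adjoin W s by exists n, v.
  apply/seteqP; split=> x; last exact: (@sub_adjoin _ _ _ [:: w]).
  case=> c xc; rewrite -(subrK (c *: w) x).
  by apply: subspaceD => //; exact: subspaceZ.
pose u (i : 'I_n.+1) := oapp v w (unlift ord_max i).
have sumu (c : 'I_n.+1 -> R[i]) : \sum_i c i *: u i =
    \sum_(i < n) c (lift ord_max i) *: v i + c ord_max *: w.
  rewrite big_ord_recr /= /u unlift_none; congr (_ + _).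
  apply: eq_bigr => i _; have -> : widen_ord (leqnSn n) i = lift ord_max i.
    by apply/val_inj => /=; rewrite /bump leqNgt ltn_ord.
  by rewrite liftK.
have sumW (c : 'I_n -> R[i]) : adjoin W s (\sum_i c i *: v i).
  elim/big_ind : _ => //; first exact: subspace0.
    by move=> x y; exact: subspaceD.
  by move=> i _; exact: subspaceZ.
exists n.+1, u; split=> [i|x [c xc]].
  rewrite /u; case: unliftP => [j _|_] /=; first exact: (@sub_adjoin _ _ _ [:: w]).
  by exists 1; rewrite scale1r subrr; exact: subspace0.
have [d [xd dP]] := bv _ xc.
exists (fun i => oapp d c (unlift ord_max i)); split.
  rewrite sumu unlift_none /= opprD addrCA addrC -addrA.
  under eq_bigr do rewrite liftK /=.
  by move: xd; rewrite -addrA (addrC (- _)) addrA addrC addrA.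
move=> e; rewrite sumu => xe.
have ec : e ord_max = c.
  apply/eqP; apply: contra_notT ws => ec.
  have : adjoin W s ((c - e ord_max) *: w).
    have -> : (c - e ord_max) *: w =
        (x - (\sum_(i < n) e (lift ord_max i) *: v i + e ord_max *: w)) -
        (x - c *: w) + \sum_(i < n) e (lift ord_max i) *: v i.
      rewrite addrAC opprD (addrC (- _)) addrA subrK opprB.
      by rewrite [RHS]addrC addrA subrK scalerBl.
    apply: subspaceD => //; apply: subspaceB => //; exact: sub_adjoin.
  move/(subspaceZ (c - e ord_max)^-1 sA).
  by rewrite scalerA mulVf ?scale1r // subr_eq0 eq_sym.
have ed : d = (fun i => e (lift ord_max i)).
  apply: dP; move: xe; rewrite ec; congr (W _).
  by rewrite opprD addrA addrAC.
apply/funext => i; case: unliftP => [j ->|->] /=; last by rewrite ec.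
by rewrite ed.
Qed.

(** Reduces every statement about nullities and defects to [finite_over]. *)
Lemma quotient_dim_finP U W : subspace U -> subspace W -> W `<=` U ->
  (quotient_dim U W < +oo)%E <-> finite_over U W.
Proof.
move=> sU sW WU; split=> [|fUW].
  move=> /ereal_inf_lt[_ [n [v [_ bv]] <-] _].
  exists (codom v) => x /bv[c [xc _]]; rewrite -(subrK (\sum_i c i *: v i) x).
  have sA : subspace (adjoin W (codom v)) by exact: subspace_adjoin.
  apply: subspaceD => //; first exact: sub_adjoin.
  elim/big_ind : _ => //; first exact: subspace0.
    by move=> y z; exact: subspaceD.
  by move=> i _; apply: subspaceZ => //; apply: mem_adjoin => //; exact: codom_f.
have [s ->] := finite_over_spanE sU sW WU fUW.
have [n [v bv]] := adjoin_basis s sW.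
apply: (@le_lt_trans _ _ (n%:R%:E)); last exact: ltry.
by apply: ereal_inf_lbound; exists n => //; exists v.
Qed.

End QuotientDim.

(** * Nullity and defect of a triangular operator matrix *)

Section OperatorAlgebra.
Variables (R : realType) (H K : hilbertType R) (T : 'B(H, K)).

Lemma op_linear : linear T. Proof. exact: linearP. Qed.
Lemma op0 : T 0 = 0. Proof. exact: linear0. Qed.
Lemma opN : {morph T : x / - x}. Proof. exact: linearN. Qed.
Lemma opD : {morph T : x y / x + y}. Proof. exact: linearD. Qed.
Lemma opB : {morph T : x y / x - y}. Proof. exact: linearB. Qed.

End OperatorAlgebra.

Section TriangularAlgebra.
Variables (R : realType) (H K : hilbertType R).
Variables (A : 'B(H)) (B : 'B(K)) (C : 'B(K, H)).
Local Notation M := (upper_triangular A B C).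

Let inl (x : H) : hsum H K := (x, 0).
Let snd (u : hsum H K) : K := u.2.

Let inl_linear : linear inl.
Proof. by move=> a x y; rewrite /inl; congr pair; rewrite /= scaler0 addr0. Qed.

Let snd_linear : linear snd.
Proof. by []. Qed.


(** The kernel of the map N(B) -> H / R(A) induced by C. *)
Definition kernel_into_range : set K := [set y | B y = 0] `&` C @^-1` range A.

(** R(A) + C N(B): its codimension is the dimension of the cokernel of the map
    N(B) -> H / R(A) induced by C. *)
Definition range_plus_kernel_image : set H :=
  [set x | exists2 y, B y = 0 & range A (x - C y)].

(** The exact sequence of the operator matrix, read modulo finite-dimensional
    spaces. *)
Lemma triangular_finiteP :
  finite_over [set u | M u = 0] [set 0] /\ finite_over [set: hsum H K] (range M)
  <->
  [/\ finite_over [set x | A x = 0] [set 0], finite_over [set: K] (range B),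
    finite_over kernel_into_range [set 0] &
    finite_over [set: H] range_plus_kernel_image].
Proof.
have s0H := @subspace1 _ H; have s0K := @subspace1 _ K.
have s0 := @subspace1 _ (hsum H K).
have sT := @subspaceT _ H.
have sM := subspace_range (op_linear M).
split=> [[kM rM]|[kA rB kBC rAC]].
  split.
  - apply: finite_over_sub (finite_over_preimage inl_linear (subspace_ker (op_linear A))
      s0 kM _) _ _ => //.
      move=> x /= Ax; rewrite /upper_triangular /inl /= Ax.
      by rewrite !op0 addr0.
    by move=> x [_ []].
  - apply: finite_over_sub (finite_over_image snd_linear rM) _ _.
      by move=> y _; exists (0, y).
    by move=> _ [_ [v _ <-] <-]; exists v.2.
  - apply: finite_over_sub (finite_over_image snd_linear kM) _ _.
      move=> y [By [x _ Ax]]; exists (- x, y) => //=.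
      by rewrite /upper_triangular /= opN Ax addNr By.
    by move=> _ [_ -> <-].
  - apply: finite_over_sub (finite_over_preimage inl_linear sT sM rM _) _ _ => //.
    move=> x [_ [v _ []]] xE By; exists v.2 => //.
    by exists v.1 => //; rewrite -xE addrK.
split.
  have f1 := finite_over_preimage snd_linear (subspace_ker (op_linear M)) s0K kBC.
  apply: (finite_over_trans (f1 _)).
    move=> u [uE Bu]; split=> //; exists (- u.1) => //.
    by rewrite opN; apply/eqP; rewrite eq_sym -addr_eq0 addrC uE.
  apply: finite_over_sub (finite_over_image inl_linear kA) _ _.
    move=> [x y] [+ /= y0]; rewrite /snd /= in y0.
    rewrite y0 => -[Ax _]; exists x => //.
    by move: Ax; rewrite op0 addr0.
  by move=> _ [_ -> <-].
have f1 := finite_over_preimage snd_linear (@subspaceT _ _)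
  (subspace_range (op_linear B)) rB.
apply: (finite_over_trans (f1 _)) => //.
apply: finite_over_add (finite_over_image inl_linear rAC) _ _ => //.
  move=> _ [x [y By [x' _ Ax']] <-]; exists (x', y) => //.
  by rewrite /upper_triangular /= Ax' subrK By.
move=> u [_ [y _ By]]; exists (inl (u.1 - C y)); first by exists (u.1 - C y).
exists (0, y) => //; rewrite /upper_triangular /= op0 add0r.
case: u By => x y' /= By; congr pair; rewrite /= ?subr0 //.
by rewrite opprB addrCA subrr addr0.
Qed.

End TriangularAlgebra.

(** * The open mapping theorem modulo a closed subspace *)

Section Scalars.
Variable R : realType.
Local Notation C := R[i].

Lemma complex_archi (c : C) : exists n : nat, `|c| <= n%:R.
Proof.
exists (Num.truncn (complex.Re `|c|)).+1.
rewrite -[`|c|]RRe_real ?normr_real // -(rmorph_nat (real_complex R)) lecR.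
exact/ltW/truncnS_gt.
Qed.

Lemma complex_exp2_small (c e : C) : 0 <= c -> 0 < e ->
  exists n : nat, c / 2 ^+ n < e.
Proof.
move=> c0 e0; have [n] := complex_archi (c / e).
have ce0 : 0 <= c / e by rewrite divr_ge0 // ltW.
rewrite ger0_norm // => cn.
exists n; rewrite ltr_pdivrMr ?exprn_gt0 // mulrC -ltr_pdivrMr //.
by apply: (le_lt_trans cn); rewrite -natrX ltr_nat ltn_expl.
Qed.

Lemma lower_bound2 (a b : C) : 0 < a -> 0 < b ->
  exists c, [/\ 0 < c, c <= a & c <= b].
Proof.
move=> a0 b0; have ab0 : 0 < a + b by rewrite addr_gt0.
exists (a * b / (a + b)); rewrite !divr_gt0 ?mulr_gt0 // !ler_pdivrMr //.
by rewrite [b * _]mulrC !ler_pM2l ?ler_pM2r // lerDl lerDr !ltW.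
Qed.

End Scalars.

Section Completeness.
Variables (R : realType) (X : completeNormedModType R[i]).
Local Notation C := R[i].
Implicit Types (A : set X) (x y : X).

(** The closure of A in metric form; it keeps filters out of the estimates. *)
Definition adherent A x : Prop := forall e : C, 0 < e -> exists2 a, A a & `|x - a| < e.

Lemma closureEadherent A : closure A = adherent A.
Proof.
apply/seteqP; split=> x clx.
  move=> e e0; have [|a [Aa xa]] := clx (ball x e); first exact: nbhsx_ballx.
  by exists a => //; move: xa; rewrite -ball_normE.
move=> U /nbhs_ballP[e /= e0 xeU]; have [a Aa xa] := clx e e0.
by exists a; split=> //; apply: xeU; rewrite -ball_normE.
Qed.

Lemma closedPadherent A : closed A <-> adherent A `<=` A.
Proof. by rewrite -closureEadherent. Qed.

(** The hypothesis on norms says that the closed ball of radius r (k + 1) about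
    u (k + 1) lies in the one of radius r k about u k. *)
Lemma nested_balls (u : nat -> X) (r : nat -> C) :
  (forall k, 0 <= r k) -> (forall e, 0 < e -> exists k, r k < e) ->
  (forall k, `|u k.+1 - u k| + r k.+1 <= r k) ->
  exists l, u @ \oo --> l /\ forall k, `|l - u k| <= r k.
Proof.
move=> r0 rlim step.
have tele k j : `|u (j + k)%N - u k| + r (j + k)%N <= r k.
  elim: j => [|j IH]; first by rewrite subrr normr0 add0r.
  apply: le_trans IH; rewrite addSn.
  rewrite -[u _.+1 - _](subrKA (u (j + k)%N)).
  apply: (@le_trans _ _ (`|u (j + k).+1 - u (j + k)%N| + `|u (j + k)%N - u k|
     + r (j + k).+1)).
    by rewrite lerD2r ler_normD.
  by rewrite addrAC addrC lerD2l step.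
have dist k n : (k <= n)%N -> `|u n - u k| <= r k.
  move=> kn; rewrite -(subnK kn); apply: le_trans (tele k (n - k)%N).
  by rewrite lerDl.
have : cvg (u @ \oo).
  apply/cauchy_cvgP/cauchy_exP => e /rlim[k rk]; exists (u k).
  exists k => // n /= kn; rewrite -ball_normE /= distrC.
  exact: le_lt_trans (dist _ _ kn) rk.
move=> /cvg_ex[l ul]; exists l; split=> // k.
apply/ler_addgt0Pr => e e0.
have [N _ lN] : \forall n \near \oo, `|l - u n| < e.
  by move/cvgrPdist_lt : ul; exact.
rewrite -(subrKA (u (N + k)%N)) addrC.
apply: (le_trans (ler_normD _ _)); rewrite lerD //.
  by apply: dist; rewrite leq_addl.
by apply/ltW; apply: (lN (N + k)%N); rewrite /= leq_addr.
Qed.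

(** Baire's theorem over the complex scalars: otherwise one picks nested balls,
    the n-th of which misses F n, and their common point lies in no F n. *)
Lemma Baire_cover (F : nat -> set X) : (forall x, exists n, F n x) ->
  exists n y (r : C), 0 < r /\ forall z, `|z - y| < r -> adherent (F n) z.
Proof.
move=> cover; apply: contrapT => noball.
have step (p : nat * (X * C)) : exists q : X * C, 0 < p.2.2 ->
    [/\ 0 < q.2, `|q.1 - p.2.1| + q.2 <= p.2.2, q.2 <= p.2.2 / 2 &
        forall w, `|w - q.1| <= q.2 -> ~ F p.1 w].
  case: p => n [y r] /=; have [r0|r0] := boolP (0 < r); last by exists (y, r).
  have r20 : 0 < r / 2 by rewrite divr_gt0.
  have [z [zy nz]] : exists z, `|z - y| < r / 2 /\ ~ adherent (F n) z.
    apply: contrapT => nz; apply: noball; exists n, y, (r / 2); split=> // z zy.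
    by apply: contrapT => nFz; apply: nz; exists z.
  have [rho [rho0 rhoF]] : exists rho : C, 0 < rho /\
      forall w, F n w -> ~ `|z - w| < rho.
    apply: contrapT => nrho; apply: nz => e e0; apply: contrapT => ne.
    by apply: nrho; exists e; split=> // w Fw we; apply: ne; exists w.
  have [c [c0 cr crho]] := lower_bound2 r20 (divr_gt0 rho0 (ltr0n _ 2)).
  exists (z, c) => _; split=> //=.
    by rewrite [leRHS]splitr lerD // ltW.
  move=> w wz Fw; apply: (rhoF w Fw); rewrite distrC.
  apply: (le_lt_trans wz); apply: (le_lt_trans crho).
  by rewrite ltr_pdivrMr // ltr_pMr // ltr1n.
have [f fP] := choice step.
pose fix b n := if n is k.+1 then f (k, b k) else (0 : X, 1 : C).
have b0 n : 0 < (b n).2 by elim: n => //= n IH; have [] := fP (n, b n) IH.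
have bP n := fP (n, b n) (b0 n).
have bexp n : (b n).2 <= 1 / 2 ^+ n.
  elim: n => [|n IH]; first by rewrite expr0 divr1.
  have [_ _ /= h _] := bP n; apply: (le_trans h).
  by rewrite exprSr invfM mulrA ler_pM2r ?invr_gt0.
have [l [_ lb]] : exists l, (fun n => (b n).1) @ \oo --> l /\
    forall k, `|l - (b k).1| <= (b k).2.
  apply: nested_balls => [k|e e0|k]; first exact: ltW.
    have [n ne] := complex_exp2_small ler01 e0.
    by exists n; exact: le_lt_trans ne.
  by have [] := bP k.
have [n Fl] := cover l; have [_ _ _ nF] := bP n.
exact: (nF l (lb n.+1)).
Qed.

End Completeness.

Lemma subrACA (V : zmodType) (x y z t : V) : (x - y) - (z - t) = (x - z) - (y - t).
Proof. by rewrite !opprD addrACA. Qed.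

(** The open mapping theorem modulo a closed subspace S of the target, that is,
    for the map induced into Y / S. *)
Section OpenMapping.
Variables (R : realType) (X Y : completeNormedModType R[i]).
Local Notation C := R[i].
Variables (T : X -> Y) (S : set Y).
Hypotheses (linT : linear T) (sS : subspace S).
Variable b : C.
Hypothesis b_ge0 : 0 <= b.
Hypothesis T_bounded : forall x, `|T x| <= b * `|x|.
Hypothesis S_closed : closed S.
Hypothesis T_onto : forall y, exists x, S (y - T x).

(** By Baire, for some n every point of a ball is a limit of points T x + s with
    |x| <= n and s in S. Differences of two such points approximate every vector
    of a ball about 0, and rescaling gives a relative error of one half. *)
Let approx : exists2 c : C, 0 <= c & forall y, exists x s,
  [/\ `|x| <= c * `|y|, S s & `|y - T x - s| <= `|y| / 2].
Proof.
have [|n [y0 [r [r0 ball_adh]]]] :=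
    Baire_cover (F := fun n => [set y | exists2 x, `|x| <= n%:R & S (y - T x)]).
  by move=> y; have [x Sx] := T_onto y; have [n xn] := complex_archi `|x|;
     exists n; exists x => //; rewrite normr_id in xn.
(* Scaling by k = (r / 2) / |y| moves y into the ball of radius r, where
   approximate solutions of norm at most 2 n are available. *)
exists (n%:R * 4 / r) => [|y]; first by rewrite divr_ge0 ?mulr_ge0 // ltW.
have [->|y_neq0] := eqVneq y 0.
  exists 0, 0; split; [by rewrite !normr0 mulr0|exact: subspace0|].
  by rewrite (linear_map0 linT) !subr0 !normr0 mul0r.
have y_gt0 : 0 < `|y| by rewrite normr_gt0.
pose k := r / 2 / `|y|; have k0 : 0 < k by rewrite !divr_gt0.
have e0 : 0 < k * (`|y| / 4) by rewrite mulr_gt0 ?divr_gt0.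
have [|f1 [x1 x1n Sx1] f1e] := ball_adh (y0 + k *: y) _ _ e0.
  rewrite addrC addKr normrZ gtr0_norm // divfK ?gt_eqF //.
  by rewrite ltr_pdivrMr // ltr_pMr // ltr1n.
have [|f2 [x2 x2n Sx2] f2e] := ball_adh y0 _ _ e0; first by rewrite subrr normr0.
exists (k^-1 *: (x1 - x2)), (k^-1 *: ((f1 - T x1) - (f2 - T x2))); split.
- rewrite normrZ gtr0_norm ?invr_gt0 // mulrC.
  have -> : n%:R * 4 / r * `|y| = (n%:R + n%:R) / k.
    rewrite /k !invf_div; field.
    by rewrite gt_eqF.
  rewrite ler_pM2r ?invr_gt0 //.
  by apply: (le_trans (ler_normB _ _)); exact: lerD.
- by apply: subspaceZ => //; exact: subspaceB.
- rewrite (linear_mapZ _ linT) (linear_mapB linT) -addrA -opprD -scalerDr.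
  have -> : T x1 - T x2 + (f1 - T x1 - (f2 - T x2)) = f1 - f2.
    by rewrite subrACA addrC subrK.
  have -> : y - k^-1 *: (f1 - f2) = k^-1 *: (k *: y - (f1 - f2)).
    by rewrite [RHS]scalerBr scalerA mulVf ?gt_eqF // scale1r.
  rewrite normrZ gtr0_norm ?invr_gt0 // mulrC ler_pdivrMr //.
  have -> : k *: y - (f1 - f2) = (y0 + k *: y - f1) - (y0 - f2).
    by rewrite subrACA [y0 + _]addrC addrK.
  apply: (le_trans (ler_normB _ _)); apply/ltW.
  have -> : `|y| / 2 * k = k * (`|y| / 4) + k * (`|y| / 4) by field.
  exact: ltrD.
Qed.

(** Correcting the error of [approx] again and again gives a geometric series
    of corrections. Only the x components need to converge: the accumulated
    element of S is recovered at the end because S is closed. *)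
Theorem open_mapping : exists2 c : C, 0 <= c & forall y, exists2 x,
  `|x| <= c * `|y| & S (y - T x).
Proof.
have [c c0 /choice[x /choice[s xsP]]] := approx.
exists (c * 2) => [|y]; first by rewrite mulr_ge0.
pose fix res n := if n is k.+1 then res k - T (x (res k)) - s (res k) else y.
pose u n := \sum_(k < n) x (res k).
have resE n : `|res n| <= `|y| / 2 ^+ n.
  elim: n => [|n IH]; first by rewrite expr0 divr1.
  have [_ _ h] := xsP (res n); apply: (le_trans h).
  by rewrite exprSr invfM mulrA ler_pM2r ?invr_gt0.
have uE n : S (y - T (u n) - res n).
  elim: n => [|n IH] /=.
    by rewrite /u big_ord0 (linear_map0 linT) subr0 subrr; exact: subspace0.
  have [_ Ss _] := xsP (res n); have := subspaceD sS IH Ss; congr S.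
  rewrite /u big_ord_recr /= -/(u n) (linear_mapD linT).
  rewrite [X in _ = _ - X]addrAC opprD addrA [RHS]subrACA subrr subr0.
  by rewrite opprB addrA [RHS]addrAC.
have [l [_ lu]] : exists l, u @ \oo --> l /\
    forall k, `|l - u k| <= c * 2 * `|y| / 2 ^+ k.
  have cy0 : 0 <= c * 2 * `|y| by rewrite !mulr_ge0.
  apply: nested_balls => [k|e e0|k]; first by rewrite divr_ge0 ?exprn_ge0.
    exact: complex_exp2_small.
  rewrite /u big_ord_recr /= [_ + x _]addrC addrK.
  have [h _ _] := xsP (res k).
  have -> : c * 2 * `|y| / 2 ^+ k = c * (`|y| / 2 ^+ k) + c * 2 * `|y| / 2 ^+ k.+1.
    rewrite exprS invfM; field.
    by rewrite expf_neq0.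
  rewrite lerD2r; apply: (le_trans h); exact: ler_wpM2l.
exists l.
  by have := lu 0%N; rewrite /u big_ord0 subr0 expr0 divr1.
move/closedPadherent : S_closed; apply => e e0.
have K0 : 0 <= (b * (c * 2) + 1) * `|y|.
  by rewrite mulr_ge0 // addr_ge0 // !mulr_ge0.
have [n ne] := complex_exp2_small K0 e0.
exists (y - T (u n) - res n) => //; apply: le_lt_trans ne.
have -> : y - T l - (y - T (u n) - res n) = res n - T (l - u n).
  rewrite (linear_mapB linT) !opprB addrC -addrA; congr (_ + _).
  by rewrite subrKA.
rewrite !mulrDl mul1r [leRHS]addrC; apply: (le_trans (ler_normB _ _)).
rewrite lerD // (le_trans (T_bounded _)) //.
by rewrite -!mulrA ler_wpM2l // !mulrA.
Qed.

End OpenMapping.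

(** * Orthogonal projections and orthonormal bases *)

Section InnerProduct.
Variables (R : realType) (H : hilbertType R).
Local Notation C := R[i].
Implicit Types (x y z : H) (U W : set H).

Lemma hdotC x y : hdot x y = (hdot y x)^*.
Proof. by rewrite hermC expr0 mul1r. Qed.

Lemma hdotDl x y z : hdot (x + y) z = hdot x z + hdot y z.
Proof. exact: linearDl. Qed.
Lemma hdotBl x y z : hdot (x - y) z = hdot x z - hdot y z.
Proof. exact: linearBl. Qed.
Lemma hdotBr x y z : hdot x (y - z) = hdot x y - hdot x z.
Proof. exact: linearBr. Qed.
Lemma hdotDr x y z : hdot x (y + z) = hdot x y + hdot x z.
Proof. exact: linearDr. Qed.
Lemma hdotZl a x y : hdot (a *: x) y = a * hdot x y.
Proof. exact: linearZl_LR. Qed.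
Lemma hdotZr a x y : hdot x (a *: y) = a^* * hdot x y.
Proof. exact: linearZr_LR. Qed.
Lemma hdot0l x : hdot 0 x = 0.
Proof. exact: linear0l. Qed.
Lemma hdot0r x : hdot x 0 = 0.
Proof. exact: linear0r. Qed.
Lemma hdot_suml n (u : 'I_n -> H) x : hdot (\sum_k u k) x = \sum_k hdot (u k) x.
Proof. exact: linear_sumlz. Qed.

Lemma hdot_eq0C x y : hdot x y = 0 -> hdot y x = 0.
Proof. by move=> xy; rewrite hdotC xy conjC0. Qed.

Lemma pythagoras x y : hdot x y = 0 -> `|x + y| ^+ 2 = `|x| ^+ 2 + `|y| ^+ 2.
Proof.
move=> xy; rewrite !hdotE hdotDl !hdotDr xy (hdot_eq0C xy).
by rewrite addr0 add0r.
Qed.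

(** The one-dimensional case of orthogonal projection, and the computation
    behind both Cauchy-Schwarz and the Gram-Schmidt step. *)
Lemma hdot_residue x y : y != 0 -> hdot (x - hdot x y / `|y| ^+ 2 *: y) y = 0.
Proof.
move=> y0; rewrite hdotBl hdotZl -hdotE divfK ?subrr //.
by rewrite expf_neq0 // normr_eq0.
Qed.

Lemma cauchy_schwarz x y : `|hdot x y| <= `|x| * `|y|.
Proof.
have [->|y0] := eqVneq y 0; first by rewrite hdot0r !normr0 mulr0.
have n0 : 0 < `|y| by rewrite normr_gt0.
set c := hdot x y / `|y| ^+ 2.
have : `|c *: y| ^+ 2 <= `|x| ^+ 2.
  rewrite -(subrK (c *: y) x) pythagoras ?lerDr ?exprn_ge0 //.
  by rewrite hdotZr hdot_residue // mulr0.
rewrite ler_sqr ?nnegrE // normrZ /c normrM normfV normrX normr_id.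
by rewrite expr2 invfM -!mulrA mulVf ?gt_eqF // mulr1 ler_pdivrMr.
Qed.

Definition orthc U : set H := [set x | forall u, U u -> hdot x u = 0].

Lemma subspace_orthc U : subspace (orthc U).
Proof.
split=> [u _|a x y xU yU u Uu]; first exact: hdot0l.
by rewrite hdotDl hdotZl xU // yU // mulr0 addr0.
Qed.

(** Existence of orthogonal projections onto U. *)
Definition complemented U : Prop := forall x, exists2 p, U p & orthc U (x - p).

(** The component of x orthogonal to U is no longer than x - a, for any a in U. *)
Lemma complemented_closed U : subspace U -> complemented U -> closed U.
Proof.
move=> sU cU; apply/closedPadherent => x adx.
have [p Up qU] := cU x; suff /eqP : `|x - p| = 0.
  by rewrite normr_eq0 subr_eq0 => /eqP ->.
apply/eqP; rewrite -[_ == 0]negbK; apply/negP => q0.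
have [|a Ua] := adx `|x - p|; first by rewrite lt_def q0 /=.
apply/negP; rewrite -real_leNgt ?normr_real //.
rewrite -ler_sqr ?nnegrE // -[x - a](subrKA p) (@pythagoras (x - p)) ?lerDl ?exprn_ge0 //.
by apply: qU; exact: subspaceB.
Qed.

Lemma complemented0 : complemented [set 0].
Proof. by move=> x; exists 0 => // u ->; exact: hdot0r. Qed.

(** The Gram-Schmidt step: if q is the component of v orthogonal to U, the
    projection onto U + span v is the sum of those onto U and onto span q. *)
Lemma complemented_adjoin U s :
  subspace U -> complemented U -> complemented (adjoin U s).
Proof.
move=> sU cU; elim: s => //= v s cW.
have sW := subspace_adjoin s sU; have [p Wp qW] := cW v.
pose q := v - p => x; have [a Wa rW] := cW x.
have [q0|q0] := eqVneq q 0.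
  have Wv : adjoin U s v by rewrite -(subrK p v) -/q q0 add0r.
  exists a; first by exists 0; rewrite scale0r subr0.
  move=> y [d yd]; apply: rW; rewrite -(subrK (d *: v) y).
  by apply: subspaceD => //; exact: subspaceZ.
set c := hdot (x - a) q / `|q| ^+ 2.
exists (a + c *: q).
  exists c; rewrite scalerBr addrA addrAC addrK.
  by apply: subspaceB => //; exact: subspaceZ.
have rcW u : adjoin U s u -> hdot (x - (a + c *: q)) u = 0.
  by move=> Wu; rewrite opprD addrA hdotBl hdotZl rW // qW // mulr0 subrr.
move=> y [d yd]; rewrite -(subrK (d *: v) y) hdotDr rcW // add0r hdotZr.
rewrite -(subrK p v) hdotDr (rcW p Wp) addr0 -/q opprD addrA.
by rewrite hdot_residue // mulr0.
Qed.

Lemma complemented_finite U :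
  subspace U -> finite_over U [set 0] -> complemented U.
Proof.
move=> sU fU; have U0 : [set 0] `<=` U by move=> _ ->; exact: subspace0.
have [s ->] := finite_over_spanE sU (@subspace1 _ H) U0 fU.
by apply: complemented_adjoin; [exact: subspace1 | exact: complemented0].
Qed.

End InnerProduct.

Section Orthonormal.
Variables (R : realType) (H : hilbertType R).
Local Notation C := R[i].
Implicit Types (x y z : H) (U W : set H) (e : nat -> H).

Definition orthonormal_seq e : Prop := forall m n, hdot (e m) (e n) = (m == n)%:R.

(** Together with orthonormality in U and closedness of U, this makes e an
    orthonormal basis of U. *)
Definition complete_in U e : Prop :=
  forall x, U x -> (forall n, hdot x (e n) = 0) -> x = 0.

Definition orthonormal_set (S : set H) : Prop :=
  forall x y, S x -> S y -> hdot x y = (x == y)%:R.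

(** By Zorn's lemma. *)
Lemma maximal_orthonormal U : exists S : set H,
  [/\ S `<=` U, orthonormal_set S &
    forall x, U x -> `|x| = 1 -> ~ orthc S x].
Proof.
have [|S [[SU oS] maxS]] :=
    @Zorn_bigcup H [set S | S `<=` U /\ orthonormal_set S].
  move=> F FP totF; split=> [x [S FS Sx]|x y [S FS Sx] [S' FS' S'y]].
    by have [SU _] := FP S FS; exact: SU.
  have [SS'|S'S] := totF S S' FS FS'.
    by have [_ oS'] := FP S' FS'; apply: oS' => //; exact: SS'.
  by have [_ oS] := FP S FS; apply: oS => //; exact: S'S.
exists S; split=> // x Ux x1 xS.
have xx : hdot x x = 1 by rewrite -hdotE x1 expr1n.
apply: (maxS (S `|` [set x])).
  split; first by move=> y; left.
  move=> /(_ x (or_intror erefl)) Sx; have := xS x Sx.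
  by rewrite xx; apply/eqP; exact: oner_neq0.
have x_neq y : S y -> (x == y) = false.
  move=> Sy; apply/eqP => xy; have := xS y Sy; rewrite -xy xx.
  by apply/eqP; exact: oner_neq0.
split; first by move=> y [/SU|->].
move=> y z [Sy|->] [Sz|->]; first exact: oS.
- by rewrite eq_sym x_neq // (hdot_eq0C (xS y Sy)).
- by rewrite x_neq // xS.
- by rewrite eqxx.
Qed.

(** Distinct vectors of S are at distance sqrt 2, so points of D within 1/2 of
    them are distinct too. *)
Lemma orthonormal_set_countable S :
  separable_space H -> orthonormal_set S -> countable S.
Proof.
move=> [D cD dD] oS.
have half0 : 0 < 2^-1 :> C by rewrite invr_gt0.
have near_D x : exists d : H, D d /\ `|x - d| < 2^-1.
  have ball0 : ball x (2^-1 : C) !=set0 by exists x; exact: ballxx.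
  have [y [xy Dy]] := dD _ ball0 (ball_open x (2^-1 : C)).
  by exists y; split=> //; move: xy; rewrite -ball_normE.
have [d dP] := choice near_D.
have /countable_injP[g ginj] := cD.
apply/countable_injP; exists (g \o d) => x y /set_mem Sx /set_mem Sy /= gxy.
have dxy : d x = d y.
  by apply: ginj => //; rewrite inE; [have [] := dP x|have [] := dP y].
apply: contrapT => /eqP xy.
have : `|x - y| < 1.
  rewrite -(subrKA (d x)) [X in _ < X]splitr mul1r.
  apply: (le_lt_trans (ler_normD _ _)); rewrite ltrD //; first by have [] := dP x.
  by rewrite dxy distrC; have [] := dP y.
have n2 : `|x - y| ^+ 2 = 2.
  rewrite hdotE hdotBl !hdotBr !oS // !eqxx (eq_sym y x) (negbTE xy).
  by rewrite subr0 sub0r opprK.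
rewrite -(@ltr_pXn2r _ 2) ?nnegrE ?ler01 // n2 expr1n.
by rewrite ltrn1.
Qed.

(** A maximal orthonormal set in U is countable by separability. Were it finite,
    its span would be complemented, and by maximality equal to U. *)
Theorem exists_orthonormal_basis U : separable_space H -> subspace U ->
  ~ finite_over U [set 0] -> exists e,
    [/\ orthonormal_seq e, forall n, U (e n) & complete_in U e].
Proof.
move=> sepH sU infU; have [S [SU oS maxS]] := maximal_orthonormal U.
have completeS x : U x -> (forall s, S s -> hdot x s = 0) -> x = 0.
  move=> Ux xS; apply/eqP/negPn/negP => x0.
  have n0 : `|x| != 0 by rewrite normr_eq0.
  apply: (maxS (`|x|^-1 *: x)); first exact: subspaceZ.
    by rewrite normrZ normfV normr_id mulVf.
  by move=> s Ss; rewrite hdotZl xS // mulr0.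
have infS : infinite_set S.
  move=> /finite_seqP[s Ss]; apply: infU; exists s => x Ux.
  have s0 := @subspace1 _ H.
  have sub : adjoin [set 0] s `<=` U.
    apply: adjoin_le => // [_ ->|v vs]; first exact: subspace0.
    by apply: SU; rewrite Ss.
  have [p sp xp] := complemented_adjoin s s0 (@complemented0 _ H) x.
  suff /eqP : x - p = 0 by rewrite subr_eq0 => /eqP ->.
  apply: completeS => [|v]; first by apply: subspaceB => //; exact: sub.
  by rewrite Ss => /= vs; apply: xp; exact: mem_adjoin.
have /card_esym /ppcard_eqP[f] := eq_card_nat (orthonormal_set_countable sepH oS) infS.
exists f; split=> [m n|n|x Ux xf].
- rewrite oS; try exact: funS.
  congr (nat_of_bool _)%:R; apply/eqP/eqP => [|->//].
  by apply: (@inj _ _ _ f); rewrite inE.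
- by apply: SU; exact: funS.
apply: completeS => // s Ss.
have [n _ <-] : (f @` [set: nat]) s by have := @surj _ _ _ _ f; exact.
exact: xf.
Qed.

End Orthonormal.

(** * Unitary operators between spaces with orthonormal bases *)

Section BoundedOperators.
Variables (R : realType) (H K : hilbertType R).
Local Notation C := R[i].

Lemma op_bound (T : 'B(H, K)) : exists2 c : C, 0 <= c & forall x, `|T x| <= c * `|x|.
Proof.
have /linear_boundedP := @bounded_subproof _ _ _ T.
case=> c [creal cP]; exists (`|c| + 1); first by rewrite addr_ge0.
by apply: cP; apply: (le_lt_trans (real_ler_norm creal)); rewrite ltrDl.
Qed.

Lemma make_op (T : H -> K) (c : C) : 0 <= c -> linear T ->
  (forall x, `|T x| <= c * `|x|) -> exists S : 'B(H, K), S =1 T.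
Proof.
move=> c0 linT Tc.
pose L := HB.pack_for {linear H -> K} T (GRing.isLinear.Build _ _ _ _ _ linT).
have bL : bounded_near T (nbhs (0 : H)).
  apply/(@linear_boundedP _ _ _ L); exists c; split=> [|d cd x].
    exact: ger0_real.
  by apply: (le_trans (Tc x)); rewrite ler_wpM2r // ltW.
pose S := HB.pack_for 'B(H, K) T (GRing.isLinear.Build _ _ _ _ _ linT)
  (isBounded.Build _ _ _ _ bL).
by exists S.
Qed.

End BoundedOperators.

(** The partial sums are real, so their supremum can be taken. *)
Lemma bounded_sum_tail (R : realType) (a : nat -> R[i]) (M : R[i]) :
  (forall k, 0 <= a k) -> (forall n, \sum_(k < n) a k <= M) ->
  forall e, 0 < e -> exists N, forall j,
    \sum_(k < N + j) a k - \sum_(k < N) a k < e.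
Proof.
move=> a0 aM e e0; pose s n := complex.Re (\sum_(k < n) a k).
have sE n : \sum_(k < n) a k = real_complex R (s n).
  by rewrite RRe_real // ger0_real // sumr_ge0.
have eE : e = real_complex R (complex.Re e) by rewrite RRe_real // gtr0_real.
have hs : has_sup (range s).
  split; first by exists (s 0%N), 0%N.
  exists (complex.Re M) => _ [n _ <-].
  by have := aM n; rewrite lecE => /andP[].
have [|_ [N _ <-] sN] := sup_adherent (eps := complex.Re e) _ hs.
  by move: e0; rewrite ltcE => /andP[].
exists N => j; rewrite !sE eE -rmorphB ltcR ltrBlDl -ltrBlDr.
apply: le_lt_trans sN; rewrite lerD2r.
by apply: (sup_upper_bound hs); exists (N + j)%N.
Qed.

Section OrthonormalSums.
Variables (R : realType) (H : hilbertType R).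
Local Notation C := R[i].
Implicit Types (x y z : H) (e f : nat -> H) (c : nat -> C).

Lemma hdot_orthonormal_sum f c n m : orthonormal_seq f ->
  hdot (\sum_(k < n) c k *: f k) (f m) = if (m < n)%N then c m else 0.
Proof.
move=> onf; elim: n => [|n IH]; first by rewrite big_ord0 hdot0l.
rewrite big_ord_recr /= hdotDl IH hdotZl onf ltnS.
by case: (ltngtP m n) => [mn|mn|->]; rewrite ?mulr0 ?mulr1 ?addr0 ?add0r.
Qed.

Lemma norm_orthonormal_sum f c n j : orthonormal_seq f ->
  `|\sum_(k < n + j) c k *: f k - \sum_(k < n) c k *: f k| ^+ 2 =
  \sum_(k < n + j) `|c k| ^+ 2 - \sum_(k < n) `|c k| ^+ 2.
Proof.
move=> onf; elim: j => [|j IH]; first by rewrite addn0 !subrr normr0 expr0n.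
have f1 : `|f (n + j)%N| = 1.
  by apply/eqP; rewrite -sqrp_eq1 // hdotE onf eqxx.
rewrite addnS !big_ord_recr /= addrAC pythagoras.
  by rewrite IH normrZ f1 mulr1 addrAC.
rewrite hdotZr hdotBl !hdot_orthonormal_sum // ltnn.
by rewrite ltnNge leq_addr subrr mulr0.
Qed.

Lemma bessel e x n : orthonormal_seq e ->
  \sum_(k < n) `|hdot x (e k)| ^+ 2 <= `|x| ^+ 2.
Proof.
move=> one; pose p := \sum_(k < n) hdot x (e k) *: e k.
have xp (k : 'I_n) : hdot (x - p) (e k) = 0.
  by rewrite hdotBl (hdot_orthonormal_sum (fun k => hdot x (e k))) // ltn_ord subrr.
rewrite -[x in leRHS](subrK p) pythagoras.
  have := norm_orthonormal_sum (fun k => hdot x (e k)) 0 n one.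
  by rewrite add0n !big_ord0 !subr0 => <-; rewrite lerDr exprn_ge0.
apply: hdot_eq0C; rewrite {1}/p hdot_suml big1 // => k _.
by rewrite hdotZl (hdot_eq0C (xp k)) mulr0.
Qed.

(** Continuity of the inner product, for sequences along which it is eventually
    constant; this is the case for the orthonormal sums below. *)
Lemma cvg_hdot_const (u : nat -> H) l y (d : C) N : u @ \oo --> l ->
  (forall n, (N <= n)%N -> hdot (u n) y = d) -> hdot l y = d.
Proof.
move=> /cvgrPdist_lt ul ud; apply/eqP; rewrite -subr_eq0 -normr_le0.
apply/ler_addgt0Pr => e e0; rewrite add0r.
have y0 : 0 < `|y| + 1 by rewrite ltr_wpDl.
have [n0 _ ln] := ul (e / (`|y| + 1)) (divr_gt0 e0 y0).
have /ln {}ln : (n0 <= n0 + N)%N by rewrite leq_addr.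
rewrite -(ud (n0 + N)%N) ?leq_addl // -hdotBl.
apply: (le_trans (cauchy_schwarz _ _)).
apply: (@le_trans _ _ (e / (`|y| + 1) * (`|y| + 1))); last by rewrite divfK ?gt_eqF.
by apply: ler_pM => //; [exact: ltW | rewrite lerDl].
Qed.

End OrthonormalSums.

Section Transfer.
Variables (R : realType) (H K : hilbertType R).
Local Notation C := R[i].
Variables (e : nat -> H) (f : nat -> K).
Hypotheses (one : orthonormal_seq e) (onf : orthonormal_seq f).

Let partial x n : K := \sum_(k < n) hdot x (e k) *: f k.

(** The partial isometry taking each e n to f n and vanishing on the orthogonal
    complement of all e n. *)
Definition transfer x : K := lim (partial x @ \oo).

Let partial0 x n : `|partial x n| <= `|x|.
Proof.
rewrite -ler_sqr ?nnegrE //; apply: le_trans (bessel x n one).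
have := norm_orthonormal_sum (fun k => hdot x (e k)) 0 n onf.
by rewrite add0n !big_ord0 !subr0 => <-.
Qed.

(** By Bessel's inequality the squared coefficients are summable, and orthonormal
    sums are Cauchy as soon as their squared coefficients are summable. *)
Lemma transfer_cvg x : (fun n => \sum_(k < n) hdot x (e k) *: f k) @ \oo --> transfer x.
Proof.
apply/cauchy_cvgP/cauchy_exP => d d0.
have [||N tail] := bounded_sum_tail (a := fun k => `|hdot x (e k)| ^+ 2)
    (M := `|x| ^+ 2) _ _ (exprn_gt0 2 d0).
- by move=> k; rewrite exprn_ge0.
- by move=> n; exact: bessel.
exists (partial x N), N => // n /= Nn; rewrite -ball_normE /= distrC.
rewrite -(@ltr_pXn2r _ 2) ?nnegrE //; last exact: ltW.
rewrite -(subnKC Nn) /partial.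
by rewrite (norm_orthonormal_sum (fun k => hdot x (e k))) // tail.
Qed.

Lemma transfer_linear : linear transfer.
Proof.
move=> a x y; apply: (@norm_cvg_unique _ _ (partial (a *: x + y) @ \oo)).
  exact: transfer_cvg.
have -> : partial (a *: x + y) = (fun n => a *: partial x n + partial y n).
  apply/funext => n; rewrite /partial scaler_sumr -big_split /=.
  by apply: eq_bigr => k _; rewrite hdotDl hdotZl scalerDl scalerA.
by apply: cvgD; [apply: cvgZr; exact: transfer_cvg | exact: transfer_cvg].
Qed.

Lemma transfer_le x : `|transfer x| <= 1 * `|x|.
Proof.
rewrite mul1r; apply/ler_addgt0Pr => d d0.
have /cvgrPdist_lt /(_ d d0) [n _ tn] := @transfer_cvg x.
rewrite -(subrK (partial x n) (transfer x)) addrC.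
apply: (le_trans (ler_normD _ _)); rewrite lerD //.
by apply/ltW; apply: (tn n) => /=.
Qed.

Lemma transfer_hdot x n : hdot (transfer x) (f n) = hdot x (e n).
Proof.
apply: (cvg_hdot_const (N := n.+1) (@transfer_cvg x)) => m nm.
by rewrite (hdot_orthonormal_sum (fun k => hdot x (e k))) // nm.
Qed.

Lemma transfer_closed (U : set K) x : subspace U -> closed U ->
  (forall n, U (f n)) -> U (transfer x).
Proof.
move=> sU /closedPadherent cU fU; apply: cU => d d0.
have /cvgrPdist_lt /(_ d d0) [n _ tn] := @transfer_cvg x.
exists (partial x n); last by apply: (tn n) => /=.
rewrite /partial; elim/big_ind : _ => [|y z|k _].
- exact: subspace0.
- exact: subspaceD.
- exact: subspaceZ.
Qed.

End Transfer.

Section Bases.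
Variables (R : realType) (H K : hilbertType R).
Implicit Types (U : set H).

Lemma basis_expansion U (e : nat -> H) x : subspace U -> closed U ->
  orthonormal_seq e -> (forall n, U (e n)) -> complete_in U e ->
  U x -> transfer e e x = x.
Proof.
move=> sU cU one eU ce Ux; apply/eqP; rewrite -subr_eq0; apply/eqP; apply: ce.
  by apply: subspaceB => //; exact: transfer_closed.
by move=> n; rewrite hdotBl transfer_hdot // subrr.
Qed.

(** The projection is [transfer e e], the orthonormal expansion. *)
Lemma complemented_basis U (e : nat -> H) : subspace U -> closed U ->
  orthonormal_seq e -> (forall n, U (e n)) -> complete_in U e -> complemented U.
Proof.
move=> sU cU one eU ce x; exists (transfer e e x); first exact: transfer_closed.
move=> u Uu; apply: hdot_eq0C.
rewrite -(basis_expansion sU cU one eU ce Uu).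
apply: (cvg_hdot_const (N := 0) (@transfer_cvg _ _ _ e e one one u)) => n _.
rewrite hdot_suml big1 // => k _.
by rewrite hdotZl [X in _ * X]hdot_eq0C ?mulr0 // hdotBl transfer_hdot // subrr.
Qed.

Lemma complemented_closed_subspace U : separable_space H -> subspace U ->
  closed U -> complemented U.
Proof.
move=> sepH sU cU; have [fU|infU] := pselect (finite_over U [set 0]).
  exact: complemented_finite.
have [e [one eU ce]] := exists_orthonormal_basis sepH sU infU.
exact: complemented_basis ce.
Qed.

(** The two transfers are mutually inverse, since both composites preserve all
    coefficients with respect to a complete sequence. *)
Lemma unitary_between_bases (e : nat -> H) (f : nat -> K) :
  orthonormal_seq e -> complete_in [set: H] e ->
  orthonormal_seq f -> complete_in [set: K] f ->
  exists2 T : 'B(H, K), invertible_op T &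
    forall x n, hdot (T x) (f n) = hdot x (e n).
Proof.
move=> one ce onf cf.
have [T TE] := make_op ler01 (transfer_linear one onf) (transfer_le one onf).
have [S SE] := make_op ler01 (transfer_linear onf one) (transfer_le onf one).
exists T => [|x n]; last by rewrite TE transfer_hdot.
exists S; split=> x; apply/eqP; rewrite -subr_eq0; apply/eqP.
  by apply: ce => // n; rewrite hdotBl SE transfer_hdot // TE transfer_hdot // subrr.
by apply: cf => // n; rewrite hdotBl TE transfer_hdot // SE transfer_hdot // subrr.
Qed.

(** Merging bases of a subspace and of its complement into one sequence makes
    [unitary_between_bases] applicable to orthogonal sums. *)
Definition interleave (e e' : nat -> H) n := if odd n then e' n./2 else e n./2.

Lemma interleave_even e e' n : interleave e e' n.*2 = e n.
Proof. by rewrite /interleave odd_double doubleK. Qed.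

Lemma interleave_odd e e' n : interleave e e' n.*2.+1 = e' n.
Proof. by rewrite /interleave /= odd_double /= uphalf_double. Qed.

Lemma orthonormal_interleave e e' : orthonormal_seq e -> orthonormal_seq e' ->
  (forall m n, hdot (e m) (e' n) = 0) -> orthonormal_seq (interleave e e').
Proof.
move=> one one' ee' m n.
rewrite -[in RHS](odd_double_half m) -[in RHS](odd_double_half n) /interleave.
case: (odd m); case: (odd n) => /=.
- by rewrite one' eqn_add2l -!mul2n eqn_pmul2l.
- by rewrite hdot_eq0C //; case: eqP => // /(congr1 odd); rewrite /= !odd_double.
- by rewrite ee'; case: eqP => // /(congr1 odd); rewrite /= !odd_double.
- by rewrite one eqn_add2l -!mul2n eqn_pmul2l.
Qed.

Lemma complete_interleave e e' :
  (forall x, (forall n, hdot x (e n) = 0) -> (forall n, hdot x (e' n) = 0) ->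
    x = 0) ->
  complete_in [set: H] (interleave e e').
Proof.
move=> ee' x _ xee'; apply: ee' => n.
  by rewrite -(interleave_even e e').
by rewrite -(interleave_odd e e').
Qed.

(** For x = p + q with p in U and q orthogonal to U, the coefficients of q with
    respect to e' are those of x. *)
Lemma mem_complemented U (e' : nat -> H) x : subspace U -> complemented U ->
  (forall n, orthc U (e' n)) -> complete_in (orthc U) e' ->
  (forall n, hdot x (e' n) = 0) -> U x.
Proof.
move=> sU cU eU ce xe; have [p Up xp] := cU x.
suff /eqP : x - p = 0 by rewrite subr_eq0 => /eqP ->.
apply: ce => // n; rewrite hdotBl xe sub0r (hdot_eq0C (eU n p Up)).
by rewrite oppr0.
Qed.

End Bases.

(** * Fredholm completions of a triangular operator matrix *)

Section ClosedImage.
Variables (R : realType) (H K : hilbertType R) (T : 'B(H, K)).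
Local Notation C := R[i].

(** Let S be a finite-dimensional complement of the range, and y a limit of
    points T v with v in V. Solving T x = y - T v modulo S with small x puts
    T (v + x) in y + S, where the range has at most one point T z. So v + x - z
    lies in the kernel, hence in V, and z is the limit of the points z - x of V;
    moreover y = T z. *)
Theorem closed_image (V : set H) : finite_over [set: K] (range T) ->
  subspace V -> closed V -> (forall x, T x = 0 -> V x) -> closed (T @` V).
Proof.
move=> [s sT] sV cV kV; have linT := op_linear T.
have sR := subspace_range linT; have s0 := @subspace1 _ K.
have [t [_ Tt T0]] := finite_complement s sR.
have sS := subspace_adjoin t s0.
have cS : closed (adjoin [set 0] t).
  apply: complemented_closed => //; apply: complemented_adjoin => //.
  exact: complemented0.
have [b b0 Tb] := op_bound T.
have onto y : exists x, adjoin [set 0] t (y - T x).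
  by have [_ [x _ <-] yx] := Tt y (sT y I); exists x.
have [c c0 cP] := open_mapping linT sS b0 Tb cS onto.
apply/closedPadherent => y ady.
have lift e : 0 < e -> exists v x, [/\ V v, `|y - T v| < e, `|x| <= c * e &
    adjoin [set 0] t (y - T (v + x))].
  move=> e0; have [_ [v Vv <-] yv] := ady e e0; have [x xc yx] := cP (y - T v).
  exists v, x; split=> //; last by rewrite opD opprD addrA.
  by apply: (le_trans xc); rewrite ler_wpM2l // ltW.
have [v1 [x1 [_ _ _ z1]]] := lift 1 ltr01; set z := v1 + x1 in z1.
have near e : 0 < e -> exists x, [/\ V (z - x), `|x| <= c * e &
    `|y - T z| <= e + b * (c * e)].
  move=> e0; have [v [x [Vv yv xe yvx]]] := lift e e0; exists x.
  have zT : T z = T (v + x).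
    apply/eqP; rewrite -subr_eq0; apply/eqP/T0; split.
      by exists (z - (v + x)) => //; rewrite opB.
    have -> : T z - T (v + x) = (y - T (v + x)) - (y - T z).
      by rewrite subrACA subrr sub0r opprB.
    exact: subspaceB.
  split=> //.
    have -> : z - x = v + (z - (v + x)) by rewrite [RHS]addrCA opprD addNKr.
    by apply: subspaceD => //; apply: kV; rewrite opB zT subrr.
  rewrite zT opD opprD addrA; apply: (le_trans (ler_normB _ _)).
  by rewrite lerD //; [exact: ltW | apply: (le_trans (Tb x)); rewrite ler_wpM2l].
pose k := 1 + c + b * c.
have k1 : 1 + c + b * c > 0 by rewrite -addrA ltr_pwDl // addr_ge0 // mulr_ge0.
have near0 d : 0 < d -> exists x, [/\ V (z - x), `|x| <= d & `|y - T z| <= d].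
  move=> d0; have [x [Vzx xd yd]] := near (d / k) (divr_gt0 d0 k1).
  have kd : d = k * (d / k) by rewrite mulrC divfK ?gt_eqF.
  have dk0 : 0 <= d / k by apply/ltW/divr_gt0.
  exists x; split=> //; rewrite kd; [apply: (le_trans xd)|apply: (le_trans yd)].
    by rewrite ler_wpM2r // /k addrAC lerDr addr_ge0 // mulr_ge0.
  rewrite -subr_ge0; set w := d / k in dk0 *.
  by have -> : k * w - (w + b * (c * w)) = c * w; [rewrite /k; ring|rewrite mulr_ge0].
exists z.
  move/closedPadherent : cV; apply => d d0; have d20 : 0 < d / 2 by rewrite divr_gt0.
  have [x [Vzx xd _]] := near0 _ d20; exists (z - x) => //.
  by rewrite subKr; apply: (le_lt_trans xd); rewrite ltr_pdivrMr // ltr_pMr // ltr1n.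
apply/esym/eqP; rewrite -subr_eq0 -normr_le0; apply/ler_addgt0Pr => d d0.
by have [x [_ _]] := near0 d d0; rewrite add0r.
Qed.

End ClosedImage.

Section FredholmCriteria.
Variables (R : realType) (H K : hilbertType R).
Implicit Types T S : 'B(H, K).

Lemma nullity_finP T : (nullity T < +oo)%E <-> finite_over [set x | T x = 0] [set 0].
Proof.
have sk := subspace_ker (op_linear T).
apply: quotient_dim_finP => //; first exact: subspace1.
by move=> _ ->; exact: subspace0.
Qed.

Lemma defect_finP T : (defect T < +oo)%E <-> finite_over [set: K] (range T).
Proof.
by apply: quotient_dim_finP => //; exact: subspace_range (op_linear T).
Qed.

(** A finite defect already makes the operator lower semi-Fredholm. *)
Lemma Fredholm_finP T : Fredholm T <->
  finite_over [set x | T x = 0] [set 0] /\ finite_over [set: K] (range T).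
Proof.
split=> [[_ [/nullity_finP kT /defect_finP rT]]//|[/nullity_finP kT /defect_finP rT]].
by split=> //; right.
Qed.

Lemma eq_Fredholm T S : T =1 S -> Fredholm T -> Fredholm S.
Proof. by move=> /funext TS /Fredholm_finP; rewrite TS => /Fredholm_finP. Qed.

Lemma invertible_Fredholm T : invertible_op T -> Fredholm T.
Proof.
case=> S [TK SK]; apply/Fredholm_finP; split; exists [::] => x.
  by move=> /= Tx; rewrite -(TK x) Tx op0.
by move=> _; exists (S x).
Qed.

Lemma closed_kernel T : closed [set x | T x = 0].
Proof.
apply/closedPadherent => y ady; have [b b0 bT] := op_bound T.
apply/eqP; rewrite -normr_le0; apply/ler_addgt0Pr => e e0; rewrite add0r.
have b1 : 0 < b + 1 by rewrite ltr_wpDl.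
have [z Tz yz] := ady (e / (b + 1)) (divr_gt0 e0 b1).
rewrite -[T y]subr0 -Tz -opB; apply: (le_trans (bT _)).
apply: (@le_trans _ _ ((b + 1) * (e / (b + 1)))).
  by apply: ler_pM => //; [rewrite lerDl | exact: ltW].
by rewrite mulrC divfK ?gt_eqF.
Qed.

End FredholmCriteria.

Section Triangular.
Variables (R : realType) (H K : hilbertType R) (A : 'B(H)) (B : 'B(K)).

(** The subspace V consists of the pairs whose second entry lies in the
    projection of N(M) to K. This projection is finite-dimensional, so V is
    closed, and V is the sum of H and N(M), so its image under M is R(A) + 0. *)
Lemma closed_range_of_Fredholm (C : 'B(K, H)) :
  Fredholm (upper_triangular A B C) -> closed (range A).
Proof.
move=> FM; have [kM rM] := (Fredholm_finP _).1 FM.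
have [_ _ fN _] := (triangular_finiteP A B C).1 (conj kM rM).
set N := kernel_into_range A B C in fN.
have sN : subspace N.
  apply: subspaceI; first exact: subspace_ker (op_linear B).
  exact: subspace_preimage (op_linear C) (subspace_range (op_linear A)).
have cN : closed N := complemented_closed sN (complemented_finite sN fN).
pose V : set (hsum H K) := [set u | N u.2].
have sV : subspace V by case: sN => N0 sN; split=> // a u v; exact: sN.
have cV : closed V.
  apply/closedPadherent => u adu; apply: (closedPadherent _).1 cN _ _ => e e0.
  have [v Vv uv] := adu e e0; exists v.2 => //.
  exact: le_lt_trans (hsum_norm2 (u - v)) uv.
have kV u : upper_triangular A B C u = 0 -> V u.
  case: u => x y [Axy By]; split=> //; exists (- x) => //.
  by rewrite opN; apply/eqP; rewrite eq_sym -addr_eq0 addrC; apply/eqP.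
have cMV := closed_image rM sV cV kV.
apply/closedPadherent => x adx.
have [[x' y'] [By' [x'' _ Ax'']]] :
    (upper_triangular A B C @` V) ((x, 0) : hsum H K).
  apply: (closedPadherent _).1 cMV _ _ => e e0; have [_ [a _ <-] xa] := adx e e0.
  exists ((A a, 0) : hsum H K).
    exists ((a, 0) : hsum H K); first exact: subspace0.
    by congr pair; rewrite /= op0 ?addr0.
  apply: (le_lt_trans (hsum_norm_le _)).
  by rewrite /= subr0 normr0 addr0.
rewrite /upper_triangular /= => -[<- _].
by exists (x' + x'') => //; rewrite opD Ax''.
Qed.

(** The map N(B) -> H / R(A) has finite-dimensional kernel and cokernel, so its
    source and target are both finite-dimensional or neither is. *)
Lemma Fredholm_necessary (C : 'B(K, H)) : Fredholm (upper_triangular A B C) ->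
  [/\ upper_semi_Fredholm A, lower_semi_Fredholm B &
    (defect A < +oo)%E <-> (nullity B < +oo)%E].
Proof.
move=> FM.
have [kA rB kBC rAC] := (triangular_finiteP A B C).1 ((Fredholm_finP _).1 FM).
have linA := op_linear A; have linB := op_linear B; have linC := op_linear C.
have sA := subspace_range linA.
split.
- by split; [exact: closed_range_of_Fredholm FM | exact/nullity_finP].
- exact/defect_finP.
split=> [/defect_finP rA|/nullity_finP kB].
  apply/nullity_finP; apply: finite_over_trans kBC.
  exact: finite_over_preimage linC (subspace_ker linB) sA rA _.
apply/defect_finP; apply: (finite_over_trans rAC).
apply: (finite_over_add sA (finite_over_image linC kB)).
  by move=> _ [_ -> <-]; rewrite op0; exact: subspace0 sA.
by move=> x [y By Axy]; exists (C y) => //; exists y.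
Qed.

Hypotheses (sepH : separable_space H) (sepK : separable_space K).
Hypotheses (infH : ~ finite_over [set: H] [set 0])
  (infK : ~ finite_over [set: K] [set 0]).

Lemma exists_unitary : exists C : 'B(K, H), invertible_op C.
Proof.
have [e [one _ ce]] := exists_orthonormal_basis sepK (@subspaceT _ _) infK.
have [f [onf _ cf]] := exists_orthonormal_basis sepH (@subspaceT _ _) infH.
by have [C iC _] := unitary_between_bases one ce onf cf; exists C.
Qed.

(** C takes N(B) onto the orthogonal complement of R(A), and the orthogonal
    complement of N(B) onto R(A). *)
Lemma exists_matching_unitary : closed (range A) ->
  finite_over [set x | A x = 0] [set 0] -> finite_over [set: K] (range B) ->
  ~ finite_over [set: H] (range A) -> ~ finite_over [set y | B y = 0] [set 0] ->
  exists2 C : 'B(K, H), invertible_op C &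
    kernel_into_range A B C `<=` [set 0] /\
    range_plus_kernel_image A B C = [set: H].
Proof.
move=> cA kA rB rA kB.
have linA := op_linear A; have linB := op_linear B.
have sRA := subspace_range linA; have sKB := subspace_ker linB.
set RA := range A in cA rA sRA *; set KB := [set y | B y = 0] in kB sKB *.
have cplRA := complemented_closed_subspace sepH sRA cA.
have infRA : ~ finite_over RA [set 0].
  move=> fRA; apply: infH; apply: finite_over_trans kA.
  have HRA : [set: H] `<=` A @^-1` RA by move=> x _; exists x.
  have [s sP] :=
    finite_over_preimage linA (@subspaceT _ _) (@subspace1 _ _) fRA HRA.
  by exists s => x /sP; apply: adjoin_sub => y [].
have infRA' : ~ finite_over (orthc RA) [set 0].
  move=> fO; apply: rA; apply: (finite_over_add sRA fO) => [_ ->|x _].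
    exact: subspace0.
  have [p RAp xp] := cplRA x; exists (x - p) => //.
  by rewrite subKr.
have cKB : closed KB by exact: closed_kernel.
have cplKB := complemented_closed_subspace sepK sKB cKB.
have infKB' : ~ finite_over (orthc KB) [set 0].
  move=> fO; apply: infK; apply: (finite_over_trans rB).
  have [s sO] := finite_over_image linB fO; exists s => _ [y _ <-].
  have [p KBp yp] := cplKB y.
  (* B has the same range on K and on the complement of its kernel. *)
  have -> : B y = B (y - p) by rewrite opB KBp subr0.
  have /sO : (B @` orthc KB) (B (y - p)) by exists (y - p).
  by apply: adjoin_sub => _ [_ -> <-]; rewrite /= op0.
(* C will map e to f and e' to f'. *)
have [e [one eKB ce]] := exists_orthonormal_basis sepK sKB kB.
have [e' [one' eKB' ce']] := exists_orthonormal_basis sepK (subspace_orthc KB) infKB'.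
have [f [onf fRA ff]] := exists_orthonormal_basis sepH (subspace_orthc RA) infRA'.
have [f' [onf' fRA' ff']] := exists_orthonormal_basis sepH sRA infRA.
have ong : orthonormal_seq (interleave e e').
  by apply: orthonormal_interleave => // m n; apply: hdot_eq0C; exact: eKB'.
have onh : orthonormal_seq (interleave f f').
  by apply: orthonormal_interleave => // m n; exact: fRA.
have cg : complete_in [set: K] (interleave e e').
  apply: complete_interleave => y ye ye'; apply: ce => //.
  exact: mem_complemented sKB cplKB eKB' ce' ye'.
have ch : complete_in [set: H] (interleave f f').
  apply: complete_interleave => x xf xf'; apply: ff' => //.
  exact: mem_complemented sRA cplRA fRA ff xf.
have [C iC hC] := unitary_between_bases ong cg onh ch.
have hCe y n : hdot (C y) (f n) = hdot y (e n).
  by rewrite -(interleave_even f f') hC interleave_even.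
have hCe' y n : hdot (C y) (f' n) = hdot y (e' n).
  by rewrite -(interleave_odd f f') hC interleave_odd.
exists C => //; split=> [y [By RACy]|].
  by apply: ce => // n; rewrite -hCe; apply: hdot_eq0C; exact: fRA.
apply/seteqP; split=> // x _; have [p RAp xp] := cplRA x.
have [S [_ SK]] := iC; exists (S (x - p)); last by rewrite SK subKr.
apply: (mem_complemented sKB cplKB eKB' ce') => n.
by rewrite -hCe' SK xp.
Qed.

Lemma Fredholm_sufficient : upper_semi_Fredholm A -> lower_semi_Fredholm B ->
  ((defect A < +oo)%E <-> (nullity B < +oo)%E) ->
  exists2 C : 'B(K, H), invertible_op C & Fredholm (upper_triangular A B C).
Proof.
move=> [cA /nullity_finP kA] /defect_finP rB AB.
have [rA|rA] := pselect (finite_over [set: H] (range A)).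
  have /nullity_finP kB : (nullity B < +oo)%E by apply/AB/defect_finP.
  have [C iC] := exists_unitary; exists C => //.
  apply/Fredholm_finP/triangular_finiteP; split=> //.
    by apply: (finite_over_sub kB) => // y [].
  apply: (finite_over_sub rA) => // x RAx; exists 0; first exact: op0.
  by rewrite op0 subr0.
have kB : ~ finite_over [set y | B y = 0] [set 0].
  by move=> /nullity_finP /AB /defect_finP.
have [C iC [N0 DT]] := exists_matching_unitary cA kA rB rA kB.
exists C => //; apply/Fredholm_finP/triangular_finiteP; split=> //.
  by exists [::].
by rewrite DT; exists [::].
Qed.

End Triangular.

Lemma minus_scalar_triangular (R : realType) (H K : hilbertType R)
    (A : 'B(H)) (B : 'B(K)) (C : 'B(K, H)) (l : R[i]) :
  minus_scalar (upper_triangular A B C) l =1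
  upper_triangular (minus_scalar A l) (minus_scalar B l) C.
Proof.
move=> u; rewrite /minus_scalar /upper_triangular /=.
by congr pair; rewrite /= addrAC.
Qed.

(** The condition on the minimum and maximum of the defect and the nullity says
    that exactly one of them is infinite. *)
Lemma min_lt_max_pinftyP (R : realType) (a b : \bar R) :
  (Order.min b a < Order.max b a)%E /\ Order.max b a = +oo%E <->
  ~ ((b < +oo)%E <-> (a < +oo)%E).
Proof.
have [->|b1] := eqVneq b +oo%E.
  rewrite minye maxye; have [->|a1] := eqVneq a +oo%E; first by rewrite ltxx; split=> [[]|[]].
  by rewrite ltey a1 ltxx; split=> // _ [_ /(_ isT)].
have [->|a1] := eqVneq a +oo%E.
  by rewrite miney maxey ltey b1 ltxx; split=> // _ [/(_ isT)].
rewrite !ltey a1 b1; split=> [[_ /eqP]|[]//].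
by rewrite maxEge; case: ifP => _ /eqP; [move/eqP: b1|move/eqP: a1].
Qed.

Theorem theorem2 (R : realType) (H K : hilbertType R)
    (A : 'B(H)) (B : 'B(K))
    (sepH : separable_space H) (sepK : separable_space K)
    (infH : subspace_dim [set: H] = +oo%E) (infK : subspace_dim [set: K] = +oo%E) :
  let M (C : 'B(K, H)) : 'B(hsum H K) := upper_triangular A B C in
  \bigcap_(C in [set C : 'B(K, H) | Fredholm C]) sigma_e (M C) =
  \bigcap_(C in [set C : 'B(K, H) | invertible_op C]) sigma_e (M C) /\
  \bigcap_(C in [set C : 'B(K, H) | invertible_op C]) sigma_e (M C) =
  \bigcap_(C in [set: 'B(K, H)]) sigma_e (M C) /\
  \bigcap_(C in [set: 'B(K, H)]) sigma_e (M C) =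
  sigma_SFp A `|` sigma_SFm B `|`
  [set l : R[i] |
    let b := defect (minus_scalar A l) in
    let a := nullity (minus_scalar B l) in
    (Order.min b a < Order.max b a)%E /\ Order.max b a = +oo%E].
Proof.
move=> M; set X := \bigcap_(C in [set C | Fredholm C]) _.
set Y := \bigcap_(C in [set C | invertible_op C]) _.
set Z := \bigcap_(C in setT) _; set E := _ `|` _ `|` _.
have ZX : Z `<=` X by move=> l Zl C _; exact: Zl.
have XY : X `<=` Y by move=> l Xl C /invertible_Fredholm; exact: Xl.
have inf (L : hilbertType R) : subspace_dim [set: L] = +oo%E ->
    ~ finite_over [set: L] [set 0].
  move=> infL fL; have : (subspace_dim [set: L] < +oo)%E.
    by apply/quotient_dim_finP => //; exact: subspace1.
  by rewrite infL ltxx.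
have YE : Y `<=` E.
  move=> l Yl; apply: contrapT => nE.
  have SFA : upper_semi_Fredholm (minus_scalar A l).
    by apply: contrapT => nA; apply: nE; left; left.
  have SFB : lower_semi_Fredholm (minus_scalar B l).
    by apply: contrapT => nB; apply: nE; left; right.
  have [|C iC FC] := Fredholm_sufficient sepH sepK (inf _ infH) (inf _ infK) SFA SFB.
    by apply: contrapT => nAB; apply: nE; right; exact/min_lt_max_pinftyP.
  apply: (Yl C iC); apply: eq_Fredholm FC => u.
  exact/esym/minus_scalar_triangular.
have EZ : E `<=` Z.
  move=> l El C _ FM.
  have [SFA SFB AB] := Fredholm_necessary
    (eq_Fredholm (minus_scalar_triangular A B C l) FM).
  by case: El => [[|]//|/min_lt_max_pinftyP].
have YZ : Y = Z by apply/seteqP; split=> [l /YE /EZ|l /ZX /XY].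
split; last by split=> //; apply/seteqP; split=> // l /ZX /XY /YE.
by apply/seteqP; split=> // l; rewrite YZ => /ZX.
Qed.
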